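(* Let $X$ be a real algebraic variety and $Z\subset X$ an irreducible subvariety that is not contained in the singular locus of $X$. Let $f$ be a rational function on $X$ with continuous extension $f^c:X\to\mathbb{R}$. Then there is a Zariski dense open subset $Z^0\subset Z$ such that $f^c|_{Z^0}$ is a regular function.
   Context: A real algebraic variety is identified with its set of real points, regarded as a Zariski locally closed subset of some $\mathbb{R}^N$ (possibly reducible or singular). Continuity of functions always refers to the Euclidean topology, and functions are real valued. A function $h$ on a real algebraic variety $X$ is regular at $x\in X$ if one can write $h=p/q$ near $x$ with $p,q$ polynomials and $q(x)\neq 0$; it is regular if it is regular at every point of $X$. A rational function on $X$ is (the class of) a regular function on a Zariski dense Zariski open subset of $X$. A rational function $f$ on $X$ has continuous extension $f^c$ if $f^c:X\to\mathbb{R}$ is a continuous function that agrees with $f$ on a Zariski dense open subset of $X$. When every Zariski dense open subset of $X$ is dense in the Euclidean topology (for example, when $X$ is smooth), $f^c$ agrees with $f$ wherever $f$ is defined and is uniquely determined by $f$. *)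

(* Defs.v *)
From mathcomp Require Import all_boot all_order all_algebra.
From mathcomp Require Import boolp classical_sets reals topology normedtype.
(* The notations of mpoly clash with those of mathcomp-analysis. *)
From mathcomp Require Import -(notations) mpoly.

Set Implicit Arguments.
Unset Strict Implicit.
Unset Printing Implicit Defensive.

Import Order.TTheory GRing.Theory Num.Theory.
Import numFieldNormedType.Exports.

Local Open Scope classical_set_scope.
Local Open Scope ring_scope.

Definition peval (R : realType) (n : nat) (p : mpoly n R)
    (x : 'rV[R]_n) : R :=
  meval (fun i => x 0 i) p.

Section Zariski.
Variables (R : realType) (n : nat).
Implicit Types (A F U V W X : set 'rV[R]_n) (x v : 'rV[R]_n).
Implicit Types p q : mpoly n R.

Definition zero_locus (S : set (mpoly n R)) : set 'rV[R]_n :=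
  [set x : 'rV[R]_n | forall p, S p -> peval p x = 0].

Definition vanishing_ideal A : set (mpoly n R) :=
  [set p | forall x, A x -> peval p x = 0].

Definition zclosed F := exists S, F = zero_locus S.

Definition zopen U := zclosed (~` U).

Definition zclosure A := zero_locus (vanishing_ideal A).

Definition zclosed_in X V := exists2 F, zclosed F & V = X `&` F.

Definition zopen_in X V := exists2 U, zopen U & V = X `&` U.

Definition zdense_in X V := V `<=` X /\ X `<=` zclosure V.

(* Zariski locally closed subset of affine space; it may be empty, reducible
   or singular. *)
Definition real_variety X :=
  exists F U, [/\ zclosed F, zopen U & X = F `&` U].

Definition irreducible A :=
  A !=set0 /\
  forall F G, zclosed F -> zclosed G -> A `<=` F `|` G -> A `<=` F \/ A `<=` G.

(* "Near x" means on a Zariski neighbourhood of x in A. *)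
Definition regular_at A (h : 'rV[R]_n -> R) x :=
  exists p q U, [/\ zopen U, U x, peval q x != 0 &
    forall y, A y -> U y -> peval q y != 0 /\ h y = peval p y / peval q y].

(* Only the values of h on A matter. *)
Definition regular_on A (h : 'rV[R]_n -> R) :=
  forall x, A x -> regular_at A h x.

(* A representative of a rational function; the values of [rat_fun] outside
   [rat_dom] are irrelevant. *)
Record rational_function X := RationalFunction {
  rat_dom : set 'rV[R]_n;
  rat_fun : 'rV[R]_n -> R;
  rat_dom_open : zopen_in X rat_dom;
  rat_dom_dense : zdense_in X rat_dom;
  rat_fun_regular : regular_on rat_dom rat_fun
}.

(* Continuity is that of the restriction of fc to X, for the subspace topology
   induced by the Euclidean topology. The condition only depends on the class
   of f, since the intersection of two Zariski dense open subsets is again one. *)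
Definition continuous_extension X (f : rational_function X)
    (fc : 'rV[R]_n -> R) :=
  {within X, continuous fc} /\
  exists U, [/\ zopen_in X U, zdense_in X U, U `<=` rat_dom f &
    forall x, U x -> fc x = rat_fun f x].

(* The classes of the g j in the coordinate ring of V are algebraically
   independent over R. *)
Definition alg_independent V (k : nat) (g : 'I_k -> mpoly n R) :=
  forall P : mpoly k R,
    (forall x, V x -> meval (fun j => peval (g j) x) P = 0) -> P = 0.

(* For V irreducible: the transcendence degree over R of the function field
   of V, which is attained by elements of the coordinate ring. *)
Definition has_dim V (d : nat) :=
  (exists g : 'I_d -> mpoly n R, alg_independent V g) /\
  (forall k (g : 'I_k -> mpoly n R), alg_independent V g -> (k <= d)%N).

(* The dimension of X at x, i.e. of the local ring of X at x: the largest
   dimension of an irreducible closed subset of X through x. *)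
Definition has_local_dim X x (d : nat) :=
  (exists V, [/\ zclosed_in X V, irreducible V, V x & has_dim V d]) /\
  (forall V k, zclosed_in X V -> irreducible V -> V x -> has_dim V k ->
    (k <= d)%N).

Definition zariski_tangent X x : set 'rV[R]_n :=
  [set v : 'rV[R]_n | forall p, vanishing_ideal X p ->
    \sum_(i < n) v 0 i * peval (mderiv i p) x = 0].

Definition has_tangent_dim X x (d : nat) :=
  exists B : 'M[R]_(d, n),
    row_free B /\ forall v, zariski_tangent X x v <-> (v <= B)%MS.

(* The local ring of X at x is regular: its embedding dimension equals its
   Krull dimension. In particular x lies on a single irreducible component. *)
Definition nonsingular_at X x :=
  exists d, has_local_dim X x d /\ has_tangent_dim X x d.

Definition singular_locus X : set 'rV[R]_n :=
  [set x | X x /\ ~ nonsingular_at X x].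

End Zariski.

(* Main.v *)
From HB Require Import structures.
Require Import Defs.
From mathcomp Require Import all_boot all_order all_algebra.
From mathcomp Require Import boolp classical_sets reals topology normedtype.
From mathcomp Require Import sequences.
From mathcomp Require Import -(notations) mpoly.
From mathcomp Require Import ring lra zify.
Set Implicit Arguments.
Unset Strict Implicit.
Unset Printing Implicit Defensive.
Import Order.TTheory GRing.Theory Num.Theory.
Import numFieldNormedType.Exports.
Local Open Scope classical_set_scope.
Local Open Scope ring_scope.

(** Let z be a point of Z at which X is nonsingular, of dimension d, and let V be
    an irreducible closed subset of X of dimension d through z. The idea is to
    approach the points of Z along analytic arcs inside X that depend
    algebraically on their starting point, and to read off the value of fc as a
    quotient of leading Taylor coefficients. For X an affine space the arcs can be
    the parallels to a fixed line; in general they are the flow lines of a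
    polynomial vector field D tangent to V.

    At z there are equations g j of X and linear forms l i with nonzero Jacobian
    determinant ([tangent_complement]). Cramer's rule provides, for every constant
    vector v, a polynomial field D that annihilates the g j and sends each l i to
    v i times the Jacobian ([adjugate_field]). The ideal of V is stable under D
    ([tangent_field_stable]): otherwise V would satisfy more than n - d equations
    with independent gradients, and would have dimension less than d
    ([dependent_of_independent_gradients]). The Taylor coefficient of degree k of a
    polynomial F along the flow line that starts at x is D^k F (x) / k!, a
    polynomial function of x. Elementary bounds make these Taylor series converge
    ([flow_line]), and by stability the flow lines that start on V remain in X for
    small times ([tangent_flow_line]).

    Some numerator and denominator of f give an identity fc * q = p on all of X,
    with q not identically zero on V ([continuous_extension_fraction]). For a
    suitable v the function q does not vanish identically on the flow line through
    z ([transversal_field]). Let m be the least exponent for which D^m q is not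
    identically zero on Z. Along the flow lines starting at points of Z that lie on
    V, fc * q = p and the continuity of fc force p to have order at least m, and
    fc = D^m p / D^m q at their starting point if D^m q does not vanish there
    ([leading_quotient]).

    It remains to see that the points of Z near z, in the Zariski topology, lie on
    V: X has a single component at the nonsingular point z ([locally_irreducible]).
    The polynomials of the ideal of V belong to the ideal of X modulo every power
    of the maximal ideal at z, because their leading forms vanish on the tangent
    space; Krull's intersection theorem ([krull_intersection]) concludes. *)

(** * Polynomial functions and weighted initial forms *)

Lemma base_digits_inj (B n : nat) (a b : 'I_n -> nat) :
  (forall i, a i < B)%N -> (forall i, b i < B)%N ->
  (\sum_i a i * B ^ i = \sum_i b i * B ^ i)%N -> a =1 b.
Proof.
elim: n a b => [|n IH] a b ha hb; first by move=> _ [].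
have shift (c : 'I_n.+1 -> nat) :
  (\sum_(i < n.+1) c i * B ^ i = c ord0 + (\sum_(i < n) c (lift ord0 i) * B ^ i) * B)%N.
  rewrite big_ord_recl expn0 muln1; congr addn; rewrite big_distrl /=.
  by apply: eq_bigr => i _; rewrite -mulnA -expnSr.
rewrite !shift => e.
have e0 : a ord0 = b ord0.
  by have := congr1 (modn^~ B) e; rewrite ![(_ + _ * B)%N]addnC !modnMDl !modn_small ?ha ?hb.
have B0 : (0 < B)%N by apply: leq_ltn_trans (ha ord0).
move: e; rewrite e0 => /addnI/eqP; rewrite eqn_pmul2r // => /eqP e.
have /= eS := IH (fun i => a (lift ord0 i)) (fun i => b (lift ord0 i))
   (fun i => ha _) (fun i => hb _) e.
by move=> i; case: (unliftP ord0 i) => [j ->|->].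
Qed.

Lemma poly_fun_eq0 (R : realType) (p : {poly R}) :
  (forall x, p.[x] = 0) -> p = 0.
Proof.
move=> h; apply/eqP/negPn/negP => p0.
pose s := [seq i%:R : R | i <- iota 0 (size p)].
have us : uniq s by rewrite map_inj_uniq ?iota_uniq // => i j /eqP; rewrite eqr_nat => /eqP.
have : (size s < size p)%N.
  by apply: max_poly_roots => //; apply/allP => x _; rewrite rootE h.
by rewrite size_map size_iota ltnn.
Qed.

(** Substituting X_i := X^(B^i) with B larger than every exponent keeps
    distinct monomials distinct, which reduces the claim to one variable. *)
Lemma mpoly_fun_eq0 (R : realType) n (p : mpoly n R) :
  (forall v, meval v p = 0) -> p = 0.
Proof.
move=> h; pose B := msize p.
pose e (m : multinom n) := (\sum_(i < n) m i * B ^ i)%N.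
pose k : {poly R} := \sum_(m <- msupp p) mcoeff m p *: 'X^(e m).
have k0 : k = 0.
  apply: poly_fun_eq0 => x; rewrite -(h (fun i => x ^+ (B ^ i))) mevalE horner_sum.
  apply: eq_bigr => m _; rewrite hornerZ hornerXn; congr (_ * _).
  rewrite /e expr_sum; apply: eq_bigr => i _.
  by rewrite -exprM mulnC.
have lt m : m \in msupp p -> forall i, (m i < B)%N.
  move=> hm i; apply: leq_ltn_trans (msize_mdeg_lt hm).
  by rewrite mdegE (bigD1 i) //= leq_addr.
apply/mpolyP => m; rewrite mcoeff0; have [hm|] := boolP (m \in msupp p); last first.
  by move/memN_msupp_eq0.
have := congr1 (fun q : {poly R} => q`_(e m)) k0.
rewrite coef0 /k coef_sum (bigD1_seq m) ?msupp_uniq //= coefZ coefXn eqxx mulr1.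
rewrite big_seq_cond big1 ?addr0 // => m' /andP[hm' ne].
rewrite coefZ coefXn; case: eqP => [E|]; last by rewrite mulr0.
case/eqP: ne; apply/mnmP => i; apply: esym.
exact: (base_digits_inj (lt _ hm) (lt _ hm') E).
Qed.

Lemma mpoly_ring_ind (R : comNzRingType) n (Q : mpoly n R -> Prop) :
  (forall c, Q (mpolyC n c)) -> (forall i, Q (mpolyX R (mnm1 i))) ->
  (forall F G, Q F -> Q G -> Q (F + G)) -> (forall F G, Q F -> Q G -> Q (F * G)) ->
  forall F, Q F.
Proof.
move=> QC QX QD QM F; rewrite [F]mpolyE.
apply: (big_ind Q) => [||m _]; [by rewrite -(mpolyC0 n R)|exact: QD|].
rewrite -mul_mpolyC; apply: (QM) => //; rewrite mpolyXE_id.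
apply: (big_ind Q) => [||j _]; [by rewrite -mpolyC1|exact: QM|].
by elim: (m j) => [|k IH]; [rewrite expr0 -mpolyC1|rewrite exprS; exact: QM].
Qed.

Section LowestWeight.
Variables (m : nat) (w : 'I_m -> nat).

Definition mweight_of (mu : multinom m) := (\sum_i w i * mu i)%N.

Lemma mmap_weight (R S : comNzRingType) (f : {rmorphism R -> S}) (s : S)
    (h : 'I_m -> S) (k : nat) (Q : mpoly m R) :
    (forall mu, mu \in msupp Q -> k <= mweight_of mu)%N ->
  mmap f (fun i => s ^+ w i * h i) Q =
  s ^+ k * \sum_(mu <- msupp Q)
     f (mcoeff mu Q) * (s ^+ (mweight_of mu - k) * mmap1 h mu).
Proof.
move=> hk; rewrite /mmap mulr_sumr big_seq [RHS]big_seq; apply: eq_bigr => mu hmu.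
rewrite [RHS]mulrCA; congr (_ * _); rewrite mulrA -exprD subnKC ?hk //.
rewrite /mmap1 /mweight_of expr_sum -big_split /=; apply: eq_bigr => i _.
by rewrite exprMn exprM.
Qed.

(** The weighted initial form Phi0 of Phi. It is characterized through all ring
    morphisms at once, because Phi gets evaluated at real numbers, at univariate
    and at multivariate polynomials: setting s = 0 in the quotient of Phi by
    s ^+ k isolates Phi0. *)
Lemma lowest_weight_form (R : comNzRingType) (Phi : mpoly m R) : Phi != 0 ->
  exists k Phi0, [/\ Phi0 != 0,
   (forall (S : comNzRingType) (f : {rmorphism R -> S}) (s : S) (h : 'I_m -> S),
      mmap f (fun i => s ^+ w i * h i) Phi0 = s ^+ k * mmap f h Phi0) &
   (forall (S : comNzRingType) (f : {rmorphism R -> S}) (s : S) (h : 'I_m -> S),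
      exists r, mmap f (fun i => s ^+ w i * h i) Phi =
        s ^+ k * (mmap f h Phi0 + s * r))].
Proof.
move=> Phi_neq0.
have ex : exists k, has (fun mu => mweight_of mu == k) (msupp Phi).
  exists (mweight_of (mlead Phi)); apply/hasP; exists (mlead Phi) => //.
  exact: mlead_supp.
pose k := ex_minn ex.
have [/hasP[mu0 mu0in /eqP mu0k] kmin] : has (fun mu => mweight_of mu == k) (msupp Phi)
    /\ forall mu, mu \in msupp Phi -> (k <= mweight_of mu)%N.
  rewrite /k; case: ex_minnP => k' hk' min'; split=> // mu hmu.
  by apply: min'; apply/hasP; exists mu.
pose Phi0 : mpoly m R :=
  \sum_(mu <- msupp Phi | mweight_of mu == k) mcoeff mu Phi *: mpolyX R mu.
have cPhi0 mu : mcoeff mu Phi0 = if mweight_of mu == k then mcoeff mu Phi else 0.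
  rewrite /Phi0 raddf_sum /= -big_filter.
  have [hin|hnin] := boolP (mu \in seq.filter (fun mu => mweight_of mu == k) (msupp Phi)).
    rewrite (bigD1_seq mu) ?filter_uniq ?msupp_uniq //= big1 => [|nu ne].
      move: hin; rewrite mem_filter => /andP[-> _].
      by rewrite mcoeffZ mcoeffX eqxx mulr1 addr0.
    by rewrite mcoeffZ mcoeffX (negbTE ne) mulr0.
  rewrite big_seq big1 => [|nu nuin]; last first.
    rewrite mcoeffZ mcoeffX; case: eqP => [E|]; last by rewrite mulr0.
    by rewrite -E nuin in hnin.
  move: hnin; rewrite mem_filter; case: eqP => //= _.
  by move/memN_msupp_eq0.
have sPhi0 mu : mu \in msupp Phi0 -> mweight_of mu = k.
  by rewrite mcoeff_msupp cPhi0; case: (mweight_of mu =P k) => // _; rewrite eqxx.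
have sRem mu : mu \in msupp (Phi - Phi0) -> (k.+1 <= mweight_of mu)%N.
  rewrite mcoeff_msupp mcoeffB cPhi0; case: (mweight_of mu =P k) => [_|ne].
    by rewrite subrr eqxx.
  rewrite subr0 -mcoeff_msupp => /kmin; rewrite leq_eqVlt => /orP[/eqP e|//].
  by case: ne.
exists k, Phi0; split.
- by apply/eqP => /(congr1 (mcoeff mu0)); rewrite cPhi0 mu0k eqxx mcoeff0 => /eqP;
     rewrite -[_ == 0]negbK -mcoeff_msupp mu0in.
- move=> S f s h; rewrite (@mmap_weight _ _ f s h k) => [|mu /sPhi0 -> //].
  congr (_ * _); rewrite [in RHS]/mmap big_seq [RHS]big_seq.
  by apply: eq_bigr => mu /sPhi0 ->; rewrite subnn expr0 mul1r.
- move=> S f s h.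
  pose r := \sum_(mu <- msupp (Phi - Phi0))
     f (mcoeff mu (Phi - Phi0)) * (s ^+ (mweight_of mu - k.+1) * mmap1 h mu).
  exists r; rewrite -{1}(subrK Phi0 Phi) raddfD /=.
  rewrite (@mmap_weight _ _ f s h k.+1 (Phi - Phi0)) // -/r.
  rewrite (@mmap_weight _ _ f s h k Phi0) => [|mu /sPhi0 -> //].
  rewrite mulrDr addrC mulrA -exprSr; congr (_ * _ + _).
  rewrite [in RHS]/mmap big_seq [RHS]big_seq.
  by apply: eq_bigr => mu /sPhi0 ->; rewrite subnn expr0 mul1r.
Qed.
End LowestWeight.

(** * Algebraic dependence by counting *)

Lemma msize_exp_le (R : comNzRingType) n (p : mpoly n R) (B k : nat) :
  (msize p <= B -> msize (p ^+ k) <= k * B.+2 + 1)%N.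
Proof.
move=> hp; elim: k => [|k IH]; first by rewrite expr0 msize1.
by rewrite exprS; apply: leq_trans (msizeM_le _ _) _; lia.
Qed.

Lemma msize_prod_exp_le (R : comNzRingType) n (I : Type) (r : seq I)
    (p : I -> mpoly n R) (t : I -> nat) (B D : nat) :
  (forall i, msize (p i) <= B)%N -> (forall i, t i < D)%N ->
  (msize (\prod_(i <- r) p i ^+ t i)%R <= size r * (D * (B + 4)) + 1)%N.
Proof.
move=> hp ht; elim: r => [|i r IH]; first by rewrite big_nil msize1.
rewrite big_cons; apply: leq_trans (msizeM_le _ _) _.
have := msize_exp_le (t i) (hp i).
have : (t i * B.+2 <= D.-1 * B.+2)%N by rewrite leq_mul2r; have := ht i; lia.
have : (D.-1 * B.+2 + 4 <= D * (B + 4))%N by have := ht i; case: D {IH ht} => //= D _; nia.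
rewrite /= mulSn.
move: (msize _) (msize _) IH => x y; lia.
Qed.

(** Perron's counting argument: the D ^ m products of powers of the f i with
    exponents below D have degrees growing linearly in D, so for large D they
    outnumber the monomials in n variables of these degrees. *)
Lemma algebraically_dependent (R : fieldType) n m (f : 'I_m -> mpoly n R) :
  (n < m)%N -> exists2 Phi : mpoly m R, Phi != 0 & mmap (@mpolyC n R) f Phi = 0.
Proof.
move=> nm; pose B := (\max_i msize (f i))%N.
pose E := (m * (B + 4)).+1; pose D := (E ^ n).+1.
pose T := {ffun 'I_m -> 'I_D}; pose U := {ffun 'I_n -> 'I_(D * E)}.
pose mT (t : T) : multinom m := Multinom [tuple (t i : nat) | i < m].
pose mU (u : U) : multinom n := Multinom [tuple (u i : nat) | i < n].
pose F (t : T) : mpoly n R := mmap1 f (mT t).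
pose A : 'M[R]_(#|T|, #|U|) :=
  \matrix_(i, j) mcoeff (mU (enum_val j)) (F (enum_val i)).
have cardTU : (#|U| < #|T|)%N.
  rewrite /T /U !card_ffun !card_ord expnMn.
  apply: leq_trans (_ : D ^ n.+1 <= _)%N; last by rewrite leq_exp2l // /D ltnS expn_gt0.
  by rewrite expnSr ltn_pmul2l ?expn_gt0.
have : kermx A != 0.
  by rewrite kermx_eq0 /row_free neq_ltn (leq_ltn_trans (rank_leq_col A)).
case/rowV0Pn => v /sub_kermxP vA v0.
pose Phi : mpoly m R := \sum_(t : T) v 0 (enum_rank t) *: mpolyX R (mT t).
have mT_inj : injective mT.
  move=> t t' /mnmP e; apply/ffunP => i; apply: val_inj.
  by have := e i; rewrite !mnmE.
exists Phi.
  case/rV0Pn: v0 => i vi; apply/eqP => /(congr1 (mcoeff (mT (enum_val i)))).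
  rewrite mcoeff0 /Phi raddf_sum /= (bigD1 (enum_val i)) //= big1 => [|t ne].
    rewrite mcoeffZ mcoeffX eqxx mulr1 addr0 enum_valK => /eqP.
    by rewrite (negbTE vi).
  rewrite mcoeffZ mcoeffX; case: eqP => [/mT_inj e|]; last by rewrite mulr0.
  by rewrite e eqxx in ne.
have -> : mmap (@mpolyC n R) f Phi = \sum_(t : T) v 0 (enum_rank t) *: F t.
  rewrite /Phi raddf_sum /=; apply: eq_bigr => t _.
  by rewrite mmapZ mmapX mul_mpolyC.
apply/mpolyP => mu; rewrite mcoeff0 raddf_sum /=.
have [hmu|hmu] := boolP [forall i, mu i < D * E]%N; last first.
  apply: big1 => t _; rewrite mcoeffZ (@memN_msupp_eq0 _ _ (F t)) ?mulr0 //.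
  move: hmu => /forallPn[i hi]; apply/negP => /msize_mdeg_lt.
  apply/negP; rewrite -leqNgt /F /mmap1.
  apply: leq_trans (@msize_prod_exp_le _ _ _ _ _ (mT t) B D _ _) _.
  - by move=> j; apply: leq_bigmax.
  - by move=> j; rewrite mnmE.
  - rewrite -sum1_size big_const_ord iter_addn_0 mul1n; apply: leq_trans (_ : D * E <= _)%N.
      by rewrite /E mulnS addnC mulnCA leq_add2r /D.
    apply: leq_trans (_ : mu i <= _)%N; first by rewrite leqNgt.
    by rewrite mdegE (bigD1 i) //= leq_addr.
pose u : U := [ffun i => Ordinal (forallP hmu i)].
have -> : mu = mU u by apply/mnmP => i; rewrite mnmE ffunE.
have /matrixP/(_ 0 (enum_rank u)) := vA.
rewrite [X in X = _]mxE [X in _ = X]mxE => e; rewrite -[RHS]e.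
rewrite [RHS](reindex (fun t : {ffun 'I_m -> 'I_D} => enum_rank t)) /=; last first.
  by exists enum_val => x _; rewrite ?enum_rankK ?enum_valK.
by apply: eq_bigr => t _; rewrite mcoeffZ mxE !enum_rankK.
Qed.

(** * Hilbert's basis theorem *)

Lemma monotone_subsequence (f : nat -> nat) :
  exists phi : nat -> nat, (forall i j, i < j -> phi i < phi j)%N /\
    (forall i j, i <= j -> f (phi i) <= f (phi j))%N.
Proof.
have min N : exists i, (N <= i)%N /\ forall j, (N <= j -> f i <= f j)%N.
  have ex : exists k, `[< exists2 i, (N <= i)%N & f i = k >].
    by exists (f N); apply/asboolP; exists N.
  case: (ex_minnP ex) => k /asboolP[i Ni fi] hk; exists i; split=> // j Nj.
  by rewrite fi; apply: hk; apply/asboolP; exists j.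
have [c hc] := choice min.
pose phi := fix phi k := if k is k'.+1 then c (phi k').+1 else c 0%N.
have phiS k : (phi k < phi k.+1)%N by have [] := hc (phi k).+1.
have phi_lt : {homo phi : i j / (i < j)%N} by apply: homo_ltn => // ? ? ?; exact: ltn_trans.
exists phi; split=> // i j; rewrite leq_eqVlt => /orP[/eqP -> //|ij].
have low : (f (phi i) <= f (phi j))%N.
  case: i ij => [|i] ij /=; first by have [_] := hc 0%N; apply.
  by have [_] := hc (phi i).+1; apply; apply: phi_lt; apply: ltn_trans ij.
exact: low.
Qed.

(** Dickson's lemma: coordinate after coordinate, a subsequence of the exponents
    can be made nondecreasing. *)
Lemma monotone_subsequence_multinom n (m : nat -> multinom n) :
  exists i j, (i < j)%N /\ mnm_add (m i) (mnm_sub (m j) (m i)) = m j.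
Proof.
suff all_below k : exists phi : nat -> nat,
    (forall i j, i < j -> phi i < phi j)%N /\
    (forall l : 'I_n, (l < k)%N -> forall i j, i <= j -> m (phi i) l <= m (phi j) l)%N.
  have [phi [phi_lt phi_le]] := all_below n.
  exists (phi 0%N), (phi 1%N); split; first exact: phi_lt.
  by apply/mnmP => l; rewrite mnmDE mnmBE subnKC // phi_le.
elim: k => [|k [phi [phi_lt phi_le]]]; first by exists id.
have [kn|kn] := ltnP k n; last first.
  exists phi; split=> // l _; apply: phi_le; exact: leq_trans (ltn_ord l) kn.
have [psi [psi_lt psi_le]] := monotone_subsequence (fun i => m (phi i) (Ordinal kn)).
exists (phi \o psi); split=> [i j ij|l]; first by apply/phi_lt/psi_lt.
rewrite ltnS leq_eqVlt => /orP[/eqP lk|lk] i j ij /=.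
  by have -> : l = Ordinal kn; [apply: val_inj|apply: psi_le].
apply: phi_le => //; move: ij; rewrite leq_eqVlt => /orP[/eqP -> //|/psi_lt].
exact: ltnW.
Qed.

Section Ideals.
Variables (A : comNzRingType).

Definition in_ideal (s : seq A) (p : A) :=
  exists c : nat -> A, p = \sum_(i < size s) c i * s`_i.

Lemma in_ideal0 s : in_ideal s 0.
Proof. by exists (fun=> 0); rewrite big1 // => i _; rewrite mul0r. Qed.

Lemma in_idealD s p q : in_ideal s p -> in_ideal s q -> in_ideal s (p + q).
Proof.
move=> [c ->] [d ->]; exists (fun i => c i + d i); rewrite -big_split /=.
by apply: eq_bigr => i _; rewrite mulrDl.
Qed.

Lemma in_idealM s a p : in_ideal s p -> in_ideal s (a * p).
Proof.
move=> [c ->]; exists (fun i => a * c i); rewrite mulr_sumr.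
by apply: eq_bigr => i _; rewrite mulrA.
Qed.

Lemma mem_in_ideal s p : p \in s -> in_ideal s p.
Proof.
move=> hp; have ip := hp; rewrite -index_mem in ip.
exists (fun i => (i == index p s)%:R); rewrite (bigD1 (Ordinal ip)) //=.
rewrite eqxx mul1r nth_index // big1 ?addr0 // => j ne.
case: eqP => [e|]; last by rewrite mul0r.
by case/eqP: ne; apply: val_inj.
Qed.

Definition is_ideal (I : set A) :=
  [/\ I 0, (forall p q, I p -> I q -> I (p + q)) & (forall a p, I p -> I (a * p))].

Lemma in_ideal_sub (I : set A) s p : is_ideal I -> (forall q, q \in s -> I q) ->
  in_ideal s p -> I p.
Proof.
move=> [I0 ID IM] sI [c ->]; elim/big_ind: _ => // i _.
by apply: IM; apply: sI; apply: mem_nth.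
Qed.
End Ideals.

(** Hilbert's basis theorem. If every finite subset failed to generate I, one
    could keep adding an ungenerated element of least leading monomial; by
    Dickson's lemma one of these leading monomials divides a later one, and
    cancelling the latter contradicts its minimality. *)
Lemma hilbert_basis (R : fieldType) n (I : set (mpoly n R)) : is_ideal I ->
  exists s, (forall p, p \in s -> I p) /\ forall p, I p -> in_ideal s p.
Proof.
move=> [I0 ID IM]; apply: contrapT => no.
have step (s : seq (mpoly n R)) : exists p, (forall p, p \in s -> I p) ->
    [/\ I p, ~ in_ideal s p &
      forall q, I q -> ~ in_ideal s q -> (mlead p <= mlead q)%O].
  have [sI|nsI] := pselect (forall p, p \in s -> I p); last by exists 0.
  have [p0 [Ip0 np0]] : exists p, I p /\ ~ in_ideal s p.
    apply: contrapT => h; apply: no; exists s; split=> // p Ip.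
    by apply: contrapT => np; apply: h; exists p.
  suff [p [Ip np pmin]] : exists p, [/\ I p, ~ in_ideal s p &
     forall q, I q -> ~ in_ideal s q -> (mlead p <= mlead q)%O] by exists p.
  move: Ip0 np0; elim/mleadrect: p0 => p IH Ip np.
  have [[q [Iq nq qp]]|h] := pselect (exists q, [/\ I q, ~ in_ideal s q &
     (mlead q < mlead p)%O]); first exact: (IH q).
  exists p; split=> // q Iq nq; rewrite leNgt; apply/negP => qp.
  by apply: h; exists q.
have [next hnext] := choice step.
pose L := fix L k := if k is k'.+1 then rcons (L k') (next (L k')) else [::].
have LI k : forall p, p \in L k -> I p.
  elim: k => //= k IH p; rewrite mem_rcons inE => /orP[/eqP ->|]; last exact: IH.
  by have [] := hnext _ IH.
have memL i j : (i < j)%N -> next (L i) \in L j.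
  elim: j => // j IH; rewrite ltnS leq_eqVlt /= mem_rcons inE => /orP[/eqP->|/IH ->].
    by rewrite eqxx.
  by rewrite orbT.
have [i [j [ij e]]] := monotone_subsequence_multinom (fun k => mlead (next (L k))).
have [Ij nj jmin] := hnext _ (LI j); have [Ii ni _] := hnext _ (LI i).
set p := next (L i) in e Ii ni; set q := next (L j) in e Ij nj jmin.
set m := mnm_sub _ _ in e.
have p0 : p != 0 by apply/eqP => p0; apply: ni; rewrite p0; exact: in_ideal0.
have q0 : q != 0 by apply/eqP => q0; apply: nj; rewrite q0; exact: in_ideal0.
pose a := mcoeff (mlead q) q / mcoeff (mlead p) p.
pose u : mpoly n R := a *: mpolyX R m.
have a0 : a != 0 by rewrite mulf_neq0 ?invr_eq0 ?mleadc_eq0.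
have u0 : u != 0.
  apply/eqP => /(congr1 (mcoeff m)); rewrite mcoeff0 mcoeffZ mcoeffX eqxx mulr1.
  by move/eqP; rewrite (negbTE a0).
have leadu : mlead u = m by rewrite mleadZ ?mleadXm.
have leadup : mlead (u * p) = mlead q by rewrite mleadM // leadu -e addmC.
have Lp : in_ideal (L j) p by apply: mem_in_ideal; exact: memL.
have nr : ~ in_ideal (L j) (q - u * p).
  move=> h; apply: nj; rewrite -(subrK (u * p) q).
  by apply: in_idealD => //; apply: in_idealM.
have /jmin/(_ nr) : I (q - u * p).
  by apply: ID => //; rewrite -mulNr; apply: IM.
have le : (mlead (q - u * p)%R <= mlead q)%O.
  by apply: le_trans (mleadB_le _ _) _; rewrite leadup joinxx.
move=> ge; have leadr : mlead (q - u * p) = mlead q by apply/eqP; rewrite eq_le le ge.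
have : q - u * p = 0.
  have lead_up : mcoeff (mlead q) (u * p) = mcoeff (mlead q) q.
    rewrite -{1}leadup mleadM // mleadcM leadu mcoeffZ mcoeffX eqxx mulr1.
    by rewrite /a divfK ?mleadc_eq0.
  by apply/eqP; rewrite -mleadc_eq0 leadr mcoeffB lead_up subrr.
by move=> r0; apply: nr; rewrite r0; exact: in_ideal0.
Qed.

(** The ascending chain condition for the ideals generated by the first terms of
    P. *)
Lemma hilbert_basis_sequence (R : fieldType) n (P : nat -> mpoly n R) :
  exists N (c : nat -> mpoly n R), P N = \sum_(i < N) c i * P i.
Proof.
pose gen N : set (mpoly n R) := [set p | exists c : nat -> mpoly n R,
  p = \sum_(i < N) c i * P i].
have gen_mono N M p : (N <= M)%N -> gen N p -> gen M p.
  move=> NM [c ->]; exists (fun i => if (i < N)%N then c i else 0).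
  rewrite (big_ord_widen _ (fun i => c i * P i) NM) big_mkcond /=.
  by apply: eq_bigr => i _; case: ifP => // _; rewrite mul0r.
have genD N p q : gen N p -> gen N q -> gen N (p + q).
  move=> [c ->] [d ->]; exists (fun i => c i + d i); rewrite -big_split /=.
  by apply: eq_bigr => i _; rewrite mulrDl.
have genM N a p : gen N p -> gen N (a * p).
  move=> [c ->]; exists (fun i => a * c i); rewrite mulr_sumr.
  by apply: eq_bigr => i _; rewrite mulrA.
have gen0 N : gen N 0.
  by exists (fun=> 0); rewrite big1 // => i _; rewrite mul0r.
pose I : set (mpoly n R) := [set p | exists N, gen N p].
have idI : is_ideal I.
  split=> [|p q [N hp] [M hq]|a p [N hp]].
  - by exists 0%N.
  - exists (maxn N M); apply: genD; [apply: gen_mono hp|apply: gen_mono hq].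
      exact: leq_maxl.
    exact: leq_maxr.
  - by exists N; apply: genM.
have [s [sI Is]] := hilbert_basis idI.
have [N hN] : exists N, forall p, p \in s -> gen N p.
  elim: s sI {Is} => [|p s IH] sI; first by exists 0%N.
  have [N hN] : exists N, forall p, p \in s -> gen N p.
    by apply: IH => q hq; apply: sI; rewrite inE hq orbT.
  have [M hM] : I p by apply: sI; rewrite inE eqxx.
  exists (maxn N M) => q; rewrite inE => /orP[/eqP ->|/hN].
    by apply: gen_mono hM; exact: leq_maxr.
  by apply: gen_mono; exact: leq_maxl.
exists N; have : in_ideal s (P N).
  apply: Is; exists N.+1; exists (fun i => (i == N)%:R).
  by rewrite big_ord_recr /= eqxx mul1r big1 ?add0r // => i _; rewrite ltn_eqF ?mul0r.
by apply: in_ideal_sub hN; split; [exact: gen0|exact: genD|exact: genM].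
Qed.

(** * Flow lines of polynomial vector fields *)

Section VectorField.
Variables (R : realType) (n : nat) (a : 'I_n -> mpoly n R).
Implicit Types F G : mpoly n R.

Definition vfield F : mpoly n R := \sum_i a i * mderiv i F.

Lemma vfieldD F G : vfield (F + G) = vfield F + vfield G.
Proof. by rewrite /vfield -big_split /=; apply: eq_bigr => i _; rewrite mderivD mulrDr. Qed.

Lemma vfieldZ c F : vfield (c *: F) = c *: vfield F.
Proof.
rewrite /vfield scaler_sumr; apply: eq_bigr => i _.
by rewrite mderivZ scalerAr.
Qed.

Lemma vfieldB F G : vfield (F - G) = vfield F - vfield G.
Proof. by rewrite -scaleN1r vfieldD vfieldZ scaleN1r. Qed.

Lemma vfield0 : vfield 0 = 0.
Proof. by have := vfieldZ 0 0; rewrite !scale0r. Qed.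

Lemma vfieldC c : vfield (mpolyC n c) = 0.
Proof. by rewrite /vfield big1 // => i _; rewrite mderivC mulr0. Qed.

Lemma vfieldM F G : vfield (F * G) = vfield F * G + F * vfield G.
Proof.
rewrite /vfield mulr_suml mulr_sumr -big_split /=; apply: eq_bigr => i _.
by rewrite mderivM; ring.
Qed.

Lemma vfield_iterD k F G :
  iter k vfield (F + G) = iter k vfield F + iter k vfield G.
Proof. by elim: k => //= k ->; rewrite vfieldD. Qed.

Lemma vfield_iterC k c : iter k.+1 vfield (mpolyC n c) = 0.
Proof. by elim: k => [|k IH]; [exact: vfieldC|rewrite iterS IH vfield0]. Qed.

Variable z : 'rV[R]_n.

(** The k-th Taylor coefficient at time 0 of F along the flow line of the
    vector field starting at z. *)
Definition tcoef k F : R := peval (iter k vfield F) z / k`!%:R.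

Lemma tcoefD k F G : tcoef k (F + G) = tcoef k F + tcoef k G.
Proof. by rewrite /tcoef vfield_iterD /peval mevalD mulrDl. Qed.

Lemma tcoefS k F : tcoef k (vfield F) = k.+1%:R * tcoef k.+1 F.
Proof.
by rewrite /tcoef -iterSr factS natrM invfM mulrCA mulVKf // pnatr_eq0.
Qed.

Lemma tcoef0M F G : tcoef 0 (F * G) = tcoef 0 F * tcoef 0 G.
Proof. by rewrite /tcoef /= fact0 !divr1 /peval mevalM. Qed.

(** Leibniz's rule divided by k!: the exponential of a derivation is
    multiplicative. *)
Lemma tcoefM k F G :
  tcoef k (F * G) = \sum_(i < k.+1) tcoef i F * tcoef (k - i) G.
Proof.
elim: k F G => [|k IH] F G; first by rewrite big_ord1 tcoef0M.
have k0 : (k.+1%:R : R) != 0 by rewrite pnatr_eq0.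
apply: (mulfI k0); rewrite -tcoefS vfieldM tcoefD !IH.
under eq_bigr do rewrite tcoefS.
under [X in _ + X]eq_bigr => i _ do rewrite tcoefS -subSn -1?ltnS //.
rewrite mulr_sumr.
under [RHS]eq_bigr => i _.
  rewrite (_ : k.+1%:R = i%:R + (k.+1 - i)%:R :> R); last first.
    by rewrite -natrD subnKC // -ltnS.
  rewrite mulrDl; over.
rewrite big_split /=; congr (_ + _).
  rewrite [RHS]big_ord_recl mul0r add0r; apply: eq_bigr => i _.
  by rewrite [RHS]mulrA subSS.
rewrite [RHS]big_ord_recr /= subnn mul0r addr0; apply: eq_bigr => i _.
by rewrite mulrCA.
Qed.

(** A bound on the degree and on the sum of the absolute values of the
    coefficients, for some expression of F as a list of monomials: repetitions
    are allowed, so that sums, products and derivatives act on such lists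
    without any cancellation to track. *)
Definition bounded_by (d : nat) (c : R) F := exists s : seq (R * multinom n),
  [/\ F = \sum_(x <- s) x.1 *: mpolyX R x.2,
      (forall x, x \in s -> mdeg x.2 <= d)%N & \sum_(x <- s) `|x.1| <= c].

Lemma bounded_by_exists F : exists d c, bounded_by d c F.
Proof.
exists (msize F), (\sum_(m <- msupp F) `|mcoeff m F|).
exists [seq (mcoeff m F, m) | m <- msupp F]; split.
- by rewrite big_map -mpolyE.
- by move=> x /mapP[m hm ->] /=; apply/ltnW/msize_mdeg_lt.
- by rewrite big_map.
Qed.

Lemma bounded_by_ge0 d c F : bounded_by d c F -> 0 <= c.
Proof. by move=> [s [_ _]]; apply: le_trans; apply: sumr_ge0 => *; exact: normr_ge0. Qed.

Lemma bounded_byW d d' c c' F :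
  (d <= d')%N -> c <= c' -> bounded_by d c F -> bounded_by d' c' F.
Proof.
move=> dd' cc' [s [e sd sc]]; exists s; split=> // [x /sd|]; last exact: le_trans cc'.
by move/leq_trans; apply.
Qed.

Lemma bounded_by0 d : bounded_by d 0 0.
Proof. by exists [::]; rewrite !big_nil. Qed.

Lemma bounded_byD d c c' F G :
  bounded_by d c F -> bounded_by d c' G -> bounded_by d (c + c') (F + G).
Proof.
move=> [s [-> sd sc]] [s' [-> sd' sc']]; exists (s ++ s'); rewrite !big_cat /=.
split=> // [x|]; last exact: lerD.
by rewrite mem_cat => /orP[/sd|/sd'].
Qed.

Lemma bounded_by_sum (I : Type) (r : seq I) d (c : I -> R) (F : I -> mpoly n R) :
  (forall i, bounded_by d (c i) (F i)) ->
  bounded_by d (\sum_(i <- r) c i) (\sum_(i <- r) F i).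
Proof.
move=> h; elim: r => [|i r IH]; first by rewrite !big_nil; exact: bounded_by0.
by rewrite !big_cons; exact: bounded_byD.
Qed.

Lemma bounded_byM d d' c c' F G :
  bounded_by d c F -> bounded_by d' c' G -> bounded_by (d + d') (c * c') (F * G).
Proof.
move=> [s [-> sd sc]] [s' [-> sd' sc']].
exists [seq (x.1 * y.1, mnm_add x.2 y.2) | x <- s, y <- s']; split.
- rewrite big_allpairs_dep mulr_suml; apply: eq_bigr => x _; rewrite mulr_sumr.
  by apply: eq_bigr => y _ /=; rewrite mpolyXD -scalerAl -scalerAr scalerA.
- by move=> _ /allpairsP[[x y] [/sd hx /sd' hy ->]] /=; rewrite mdegD leq_add.
- rewrite big_allpairs_dep; apply: le_trans (_ : (\sum_(x <- s) `|x.1|) *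
     (\sum_(x <- s') `|x.1|) <= _); last first.
    by apply: ler_pM => //; apply: sumr_ge0.
  rewrite mulr_suml; apply: ler_sum => x _; rewrite mulr_sumr.
  by apply: ler_sum => y _ /=; rewrite normrM.
Qed.

Lemma bounded_by_deriv d c F i :
  bounded_by d c F -> bounded_by d (d%:R * c) (mderiv i F).
Proof.
move=> [s [-> sd sc]].
exists [seq ((x.2 i)%:R * x.1, mnm_sub x.2 (mnm1 i)) | x : R * multinom n <- s]; split.
- rewrite big_map linear_sum /=; apply: eq_bigr => x _.
  by rewrite mderivZ mderivX scalerA mulrC.
- by move=> _ /mapP[x /sd hx ->] /=; apply: leq_trans (mdegB _ _) hx.
- rewrite big_map; apply: le_trans (_ : d%:R * \sum_(x <- s) `|x.1| <= _); last first.
    by rewrite ler_wpM2l.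
  rewrite mulr_sumr big_seq [leRHS]big_seq; apply: ler_sum => x /sd hx /=.
  rewrite normrM ler_wpM2r // ger0_norm // ler_nat; apply: leq_trans hx.
  by rewrite mdegE (bigD1 i) //= leq_addr.
Qed.

Lemma bounded_by_vfield : exists M (A : R), 0 <= A /\ forall d c F,
  bounded_by d c F -> bounded_by (d + M) (A * (d%:R * c)) (vfield F).
Proof.
have ex i : exists dc : nat * R, bounded_by dc.1 dc.2 (a i).
  by have [d [c h]] := bounded_by_exists (a i); exists (d, c).
have [b hb] := choice ex.
exists (\max_i (b i).1)%N, (\sum_i (b i).2); split.
  by apply: sumr_ge0 => i _; exact: bounded_by_ge0 (hb i).
move=> d c F hF; rewrite mulr_suml; apply: bounded_by_sum => i.
rewrite addnC; apply: bounded_byM; last exact: bounded_by_deriv.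
by apply: bounded_byW (hb i) => //; exact: leq_bigmax.
Qed.

Lemma bounded_by_eval d c F (r : R) : 1 <= r -> (forall i, `|z 0 i| <= r) ->
  bounded_by d c F -> `|peval F z| <= c * r ^+ d.
Proof.
move=> r1 zr [s [-> sd sc]]; rewrite /peval raddf_sum /=.
apply: le_trans (ler_norm_sum _ _ _) _.
have r0 : 0 <= r by apply: le_trans r1.
apply: le_trans (_ : (\sum_(x <- s) `|x.1|) * r ^+ d <= _); last first.
  by rewrite ler_wpM2r // exprn_ge0.
rewrite mulr_suml big_seq [leRHS]big_seq; apply: ler_sum => x /sd hx.
rewrite mevalZ mevalX normrM ler_wpM2l // normr_prod.
apply: le_trans (_ : r ^+ mdeg x.2 <= _); last exact: ler_weXn2l.
rewrite mdegE expr_sum; apply: ler_prod => i _; rewrite normrX exprn_ge0 //=.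
by apply: lerXn2r; rewrite ?nnegrE.
Qed.

(** The degree of the k-th iterate grows linearly in k, so that differentiating
    it k times costs a factor of order k!, which the k! of the Taylor
    coefficient compensates. *)
Lemma tcoef_bound : exists K : R, 0 < K /\ forall F, exists C : R, 0 <= C /\
  forall k, `|tcoef k F| <= C * K ^+ k.
Proof.
have [M0 [A [A0 hA0]]] := bounded_by_vfield.
pose M := M0.+1.
have hA d c F : bounded_by d c F -> bounded_by (d + M) (A * (d%:R * c)) (vfield F).
  by move=> /hA0; apply: bounded_byW => //; rewrite leq_add2l /M.
pose r := 1 + \sum_i `|z 0 i|.
have r1 : 1 <= r by rewrite lerDl sumr_ge0.
have zr i : `|z 0 i| <= r.
  rewrite /r (bigD1 i) //= addrCA lerDl addr_ge0 //; exact: sumr_ge0.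
have r0 : 0 <= r by apply: le_trans r1.
have bk d c F k : bounded_by d c F ->
   bounded_by (d + k * M) (c * (A * M%:R) ^+ k * ((d + k) ^_ k)%:R) (iter k vfield F).
  move=> hF; have c0 := bounded_by_ge0 hF; elim: k => [|k IH] /=.
    by rewrite mul0n !addn0 ffactn0 expr0 !mulr1.
  have := hA _ _ _ IH; rewrite -addnA addnC -mulSnr addnC; apply: bounded_byW => //.
  have -> : ((d + k.+1) ^_ k.+1)%:R = (d + k).+1%:R * ((d + k) ^_ k)%:R :> R.
    by rewrite addnS ffactSS natrM.
  have -> : A * ((d + k * M)%:R * (c * (A * M%:R) ^+ k * ((d + k) ^_ k)%:R)) =
    (d + k * M)%:R * (A * (c * (A * M%:R) ^+ k * ((d + k) ^_ k)%:R)) :> R by ring.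
  have -> : c * (A * M%:R) ^+ k.+1 * ((d + k).+1%:R * ((d + k) ^_ k)%:R) =
    (M * (d + k).+1)%:R * (A * (c * (A * M%:R) ^+ k * ((d + k) ^_ k)%:R)) :> R.
    by rewrite natrM exprS; ring.
  apply: ler_wpM2r; last by rewrite ler_nat /M; nia.
  by rewrite !mulr_ge0 ?exprn_ge0 ?mulr_ge0.
exists (A * M%:R * 2 * r ^+ M + 1); split.
  by rewrite ltr_wpDl // !mulr_ge0 // exprn_ge0.
move=> F; have [d [c hF]] := bounded_by_exists F.
have c0 := bounded_by_ge0 hF.
exists (c * 2 ^+ d * r ^+ d); split; first by rewrite !mulr_ge0 ?exprn_ge0.
move=> k; have := bounded_by_eval r1 zr (bk _ _ _ k hF).
rewrite /tcoef normrM normfV (ger0_norm (ler0n _ _)) => h.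
rewrite ler_pdivrMr ?ltr0n ?fact_gt0 //; apply: (le_trans h).
have hb : ((d + k) ^_ k)%:R <= 2 ^+ d * 2 ^+ k * k`!%:R :> R.
  rewrite -bin_ffact natrM ler_wpM2r // -exprD -natrX ler_nat.
  rewrite -[X in (X ^ _)%N]/(1 + 1)%N expnDn.
  have kdk : (k < (d + k).+1)%N by rewrite ltnS leq_addl.
  by rewrite (bigD1 (Ordinal kdk)) //= !exp1n !muln1 leq_addr.
have := @lerXn2r R k (A * M%:R * 2 * r ^+ M) (A * M%:R * 2 * r ^+ M + 1).
rewrite !nnegrE lerDl ler01 addr_ge0 // !mulr_ge0 ?exprn_ge0 // => /(_ isT isT isT) hK.
apply: (@le_trans _ _ (c * 2 ^+ d * r ^+ d * (A * M%:R * 2 * r ^+ M) ^+ k * k`!%:R)).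
  have -> : c * 2 ^+ d * r ^+ d * (A * M%:R * 2 * r ^+ M) ^+ k * k`!%:R =
     c * (A * M%:R) ^+ k * (2 ^+ d * 2 ^+ k * k`!%:R) * r ^+ (d + k * M) :> R.
    by rewrite exprD mulnC exprM !exprMn; ring.
  by rewrite ler_wpM2r ?exprn_ge0 // ler_wpM2l // !mulr_ge0 ?exprn_ge0 ?mulr_ge0.
by rewrite ler_wpM2r // ler_wpM2l // !mulr_ge0 ?exprn_ge0.
Qed.

Lemma geometric_tail (u : nat -> R) (C x : R) : 0 <= C -> 0 <= x <= 2^-1 ->
  (forall k, `|u k| <= C * x ^+ k) ->
  forall q p, (q <= p)%N ->
    `|\sum_(k < p) u k - \sum_(k < q) u k| <= 2 * C * x ^+ q.
Proof.
move=> C0 /andP[x0 x2] hu q p /subnKC <-; move: (p - q)%N => {p} j.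
suff : `|\sum_(k < q + j) u k - \sum_(k < q) u k| + 2 * C * x ^+ (q + j) <=
    2 * C * x ^+ q.
  by apply: le_trans; rewrite lerDl mulr_ge0 ?mulr_ge0 ?exprn_ge0.
elim: j => [|j IH]; first by rewrite addn0 subrr normr0 add0r.
apply: le_trans IH; rewrite addnS big_ord_recr /= addrAC.
apply: le_trans (lerD (ler_normD _ _) (lexx _)) _; rewrite -addrA lerD2l.
have := hu (q + j)%N; have := exprn_ge0 (q + j) x0; rewrite exprS.
set y := x ^+ _; move=> y0 hy.
have : C * (x * y) <= C * (2^-1 * y) by rewrite ler_wpM2l // ler_wpM2r.
lra.
Qed.

Lemma geometric_limit (u : nat -> R) (C x : R) : 0 <= C -> 0 <= x <= 2^-1 ->
  (forall k, `|u k| <= C * x ^+ k) ->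
  exists l, forall m, `|l - \sum_(k < m) u k| <= 2 * C * x ^+ m.
Proof.
move=> C0 hx hu; have tail := geometric_tail C0 hx hu.
pose s m := \sum_(k < m) u k; pose e m := 2 * C * x ^+ m.
have e0 m : 0 <= e m by case/andP: hx => x0 _; rewrite !mulr_ge0 // exprn_ge0.
have close k m : s k - e k <= s m + e m.
  case: (leqP k m) => [/tail|/ltnW/tail]; rewrite -/(s m) -/(s k) -/(e k) -/(e m).
    by rewrite ler_norml; have := e0 m; have := e0 k; lra.
  by rewrite ler_norml; have := e0 m; have := e0 k; lra.
pose E := [set y | exists k, y = s k - e k].
have ne : E !=set0 by exists (s 0%N - e 0%N), 0%N.
have ub m : ubound E (s m + e m) by move=> _ [k ->].
exists (sup E) => m; rewrite -/(s m) -/(e m) ler_norml; apply/andP; split.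
  have : s m - e m <= sup E.
    by apply: ub_le_sup; [exists (s 0%N + e 0%N); exact: ub|exists m].
  by lra.
have : sup E <= s m + e m by apply: ge_sup => //; exact: ub.
by lra.
Qed.

Definition tpoly m F (t : R) := \sum_(k < m) tcoef k F * t ^+ k.

Lemma tpolyD m F G t : tpoly m (F + G) t = tpoly m F t + tpoly m G t.
Proof. by rewrite -big_split /=; apply: eq_bigr => k _; rewrite tcoefD mulrDl. Qed.

Lemma tpoly0 F t : tpoly 0 F t = 0.
Proof. exact: big_ord0. Qed.

Lemma tpolyS m F t : tpoly m.+1 F t = tpoly m F t + tcoef m F * t ^+ m.
Proof. exact: big_ord_recr. Qed.

Lemma tpolyM m F G t :
  tpoly m (F * G) t = \sum_(i < m) tcoef i F * t ^+ i * tpoly (m - i) G t.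
Proof.
elim: m => [|m IH]; first by rewrite tpoly0 big_ord0.
rewrite tpolyS IH tcoefM mulr_suml [in RHS]big_ord_recr [X in _ + X = _]big_ord_recr /=.
rewrite addrA subSnn subnn tpolyS tpoly0 add0r expr0 mulr1; congr (_ + _); last exact: mulrAC.
rewrite -big_split /=; apply: eq_bigr => i _.
rewrite subSn ?(ltnW (ltn_ord i)) // tpolyS mulrDr; congr (_ + _).
have -> : t ^+ m = t ^+ i * t ^+ (m - i) by rewrite -exprD subnKC // ltnW.
by ring.
Qed.

(** The Taylor series of the coordinates converge for small t and define gamma.
    The polynomials F whose Taylor series converges to F (gamma t), geometrically
    and uniformly in t, then form a ring, by the multiplicativity of the Taylor
    coefficients; it contains the coordinates, hence every polynomial. *)
Lemma flow_line : exists (K : R) (gamma : R -> 'rV[R]_n), 0 < K /\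
  forall F, exists C : R, 0 <= C /\ forall m t, K * `|t| <= 2^-1 ->
    `|peval F (gamma t) - tpoly m F t| <= C * (K * `|t|) ^+ m.
Proof.
have [K [K0 hK]] := tcoef_bound.
have coef F : exists C : R, 0 <= C /\ forall t k, `|tcoef k F * t ^+ k| <= C * (K * `|t|) ^+ k.
  have [C [C0 hC]] := hK F; exists C; split=> // t k.
  by rewrite normrM normrX exprMn mulrA ler_wpM2r ?exprn_ge0.
have [Cx hCx] := choice (fun j => coef (mpolyX R (mnm1 j))).
have ex (jt : 'I_n * R) : exists l, K * `|jt.2| <= 2^-1 -> forall m,
    `|l - tpoly m (mpolyX R (mnm1 jt.1)) jt.2| <= 2 * Cx jt.1 * (K * `|jt.2|) ^+ m.
  case: jt => j t /=; have [ht|] := boolP (K * `|t| <= 2^-1); last by exists 0.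
  have hx : 0 <= K * `|t| <= 2^-1 by rewrite mulr_ge0 // ltW.
  have [C0 hC] := hCx j.
  by have [l hl] := geometric_limit C0 hx (hC t); exists l.
have [gam hgam] := choice ex.
pose gamma t : 'rV[R]_n := \row_j gam (j, t).
(* Products lose a factor of order m, absorbed by doubling the rate. *)
pose good F := exists C : R, 0 <= C /\ forall m t, (2 * K) * `|t| <= 2^-1 ->
    `|peval F (gamma t) - tpoly m F t| <= C * (2 * K * `|t|) ^+ m.
have K20 : 0 < 2 * K by rewrite mulr_gt0.
have y0 (t : R) : 0 <= 2 * K * `|t| by rewrite mulr_ge0 // ltW.
have x0 (t : R) : 0 <= K * `|t| by rewrite mulr_ge0 // ltW.
have xy (t : R) : K * `|t| <= 2 * K * `|t| by rewrite -mulrA ler_peMl // ler1n.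
have goodC c : good (mpolyC n c).
  exists `|c|; split=> // m t ht.
  rewrite /peval mevalC; case: m => [|m].
    by rewrite /tpoly big_ord0 subr0 expr0 mulr1.
  rewrite /tpoly big_ord_recl /= big1 => [|k _]; last first.
    by rewrite /tcoef vfield_iterC /peval meval0 !mul0r.
  rewrite /tcoef /= fact0 divr1 expr0 mulr1 /peval mevalC addr0 subrr normr0.
  by rewrite mulr_ge0 // exprn_ge0.
have goodD F G : good F -> good G -> good (F + G).
  move=> [C [C0 hC]] [C' [C'0 hC']]; exists (C + C'); split; first exact: addr_ge0.
  move=> m t ht; rewrite /peval mevalD tpolyD opprD addrACA mulrDl.
  by apply: le_trans (ler_normD _ _) _; apply: lerD; [apply: hC|apply: hC'].
have goodM F G : good F -> good G -> good (F * G).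
  move=> [C [C0 hC]] [C' [C'0 hC']].
  have [c [c0 hc]] := coef F; have [c' [c'0 hc']] := coef G.
  exists (C * C' + 2 * C * C' + 2 * c * c'); split.
    by rewrite !addr_ge0 ?mulr_ge0.
  move=> m t ht; set y := 2 * K * `|t|.
  have y1 : y <= 1 by apply: le_trans ht _; rewrite invf_le1 // ler1n.
  have x2 : 0 <= K * `|t| <= 2^-1 by rewrite x0 /=; exact: le_trans (xy t) ht.
  have hG : `|peval G (gamma t)| <= C'.
    by have := hC' 0%N t ht; rewrite /tpoly big_ord0 subr0 expr0 mulr1.
  have hF : `|peval F (gamma t)| <= C.
    by have := hC 0%N t ht; rewrite /tpoly big_ord0 subr0 expr0 mulr1.
  have ym1 : y ^+ m <= 1 by apply: exprn_ile1; [exact: y0|].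
  have hT : `|tpoly m F t| <= 2 * C.
    rewrite -[tpoly _ _ _](subKr (peval F (gamma t))).
    apply: le_trans (ler_normB _ _) _; rewrite mulr_natl mulr2n; apply: lerD => //.
    by apply: le_trans (hC m t ht) _; rewrite ler_piMr.
  have cross : `|tpoly m F t * tpoly m G t - tpoly m (F * G) t| <= 2 * c * c' * y ^+ m.
    rewrite tpolyM {1}/tpoly mulr_suml -sumrB.
    apply: le_trans (ler_norm_sum _ _ _) _.
    apply: le_trans (_ : \sum_(i < m) 2 * c * c' * (K * `|t|) ^+ m <= _).
      apply: ler_sum => i _; rewrite -mulrBr normrM.
      have im : (m - i <= m)%N by exact: leq_subr.
      have -> : 2 * c * c' * (K * `|t|) ^+ m =
          c * (K * `|t|) ^+ i * (2 * c' * (K * `|t|) ^+ (m - i)).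
        rewrite -[X in _ ^+ X](subnKC (ltnW (ltn_ord i))) exprD; ring.
      apply: ler_pM => //; exact: (geometric_tail c'0 x2 (hc' t)).
    rewrite sumr_const card_ord -[leLHS]mulr_natl mulrCA; apply: ler_wpM2l.
      by rewrite !mulr_ge0.
    have -> : y = 2 * (K * `|t|) by rewrite /y mulrA.
    rewrite [leRHS]exprMn ler_wpM2r ?exprn_ge0 // -natrX ler_nat.
    exact/ltnW/ltn_expl.
  have -> : peval (F * G) (gamma t) - tpoly m (F * G) t =
     (peval F (gamma t) - tpoly m F t) * peval G (gamma t) +
     tpoly m F t * (peval G (gamma t) - tpoly m G t) +
     (tpoly m F t * tpoly m G t - tpoly m (F * G) t).
    by rewrite /peval mevalM; ring.
  rewrite [leRHS]mulrDl [X in _ <= X + _]mulrDl; apply: le_trans (ler_normD _ _) _.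
  apply: lerD => //.
  apply: le_trans (ler_normD _ _) _; apply: lerD; rewrite normrM.
    by rewrite mulrAC; apply: ler_pM => //; exact: hC.
  by rewrite -mulrA; apply: ler_pM => //; exact: hC'.
have goodX j : good (mpolyX R (mnm1 j)).
  have [C0 hC] := hCx j; exists (2 * Cx j); split; first by rewrite mulr_ge0.
  move=> m t ht; rewrite /peval mevalXU mxE.
  apply: le_trans (hgam (j, t) _ m) _ => /=; first exact: le_trans (xy t) ht.
  by rewrite ler_wpM2l ?mulr_ge0 // lerXn2r ?nnegrE ?x0 ?y0 ?xy.
exists (2 * K), gamma; split=> //.
exact: (mpoly_ring_ind goodC goodX goodD goodM).
Qed.
End VectorField.

(** * Limits along flow lines *)

Section Limits.
Variables (R : realType).

Section Filtered.
Variables (T : Type) (Fl : set_system T) (FF : Filter Fl).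

Lemma sum_cvg (I : Type) (s : seq I) (f : T -> I -> R) (l : I -> R) :
  (forall i, f t i @[t --> Fl] --> l i) ->
  \sum_(i <- s) f t i @[t --> Fl] --> \sum_(i <- s) l i.
Proof.
move=> h; elim: s => [|i s IH].
  rewrite big_nil (_ : (fun t => _) = (fun=> 0)); first exact: cvg_cst.
  by apply/funext => t; rewrite big_nil.
rewrite big_cons (_ : (fun t => _) = (fun t => f t i + \sum_(i <- s) f t i)).
  exact: (cvgD (h i) IH).
by apply/funext => t; rewrite big_cons.
Qed.

Lemma prod_cvg (I : Type) (s : seq I) (f : T -> I -> R) (l : I -> R) :
  (forall i, f t i @[t --> Fl] --> l i) ->
  \prod_(i <- s) f t i @[t --> Fl] --> \prod_(i <- s) l i.
Proof.
move=> h; elim: s => [|i s IH].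
  rewrite big_nil (_ : (fun t => _) = (fun=> 1)); first exact: cvg_cst.
  by apply/funext => t; rewrite big_nil.
rewrite big_cons (_ : (fun t => _) = (fun t => f t i * \prod_(i <- s) f t i)).
  exact: (cvgM (h i) IH).
by apply/funext => t; rewrite big_cons.
Qed.

Lemma exp_cvg (f : T -> R) (l : R) k :
  f t @[t --> Fl] --> l -> f t ^+ k @[t --> Fl] --> l ^+ k.
Proof.
move=> h; have := @prod_cvg _ (index_enum 'I_k) (fun t _ => f t) (fun=> l) (fun=> h).
rewrite prodr_const card_ord; apply: cvg_trans.
by apply: near_eq_cvg; near=> t; rewrite prodr_const card_ord.
Unshelve. all: by end_near. Qed.

Lemma near_eq_limit (f g : T -> R) (l : R) :
  f t @[t --> Fl] --> l -> (\forall t \near Fl, f t = g t) -> g t @[t --> Fl] --> l.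
Proof. by move=> fl fg; apply: cvg_trans fl; exact: near_eq_cvg. Qed.

Lemma meval_cvg m (phi : T -> 'I_m -> R) (c : 'I_m -> R) (P : mpoly m R) :
  (forall i, phi t i @[t --> Fl] --> c i) ->
  meval (phi t) P @[t --> Fl] --> meval c P.
Proof.
move=> h; rewrite mevalE; under eq_fun do rewrite mevalE.
apply: sum_cvg => mu; apply: cvgM; first exact: cvg_cst.
by apply: prod_cvg => i; exact: exp_cvg.
Qed.
End Filtered.

Lemma row_cvg (T : Type) (Fl : set_system T) (FF : Filter Fl) n
    (g : T -> 'rV[R]_n) (z : 'rV[R]_n) :
  (forall j, g t 0 j @[t --> Fl] --> z 0 j) -> g t @[t --> Fl] --> z.
Proof.
move=> h A [P zP PA]; have : \forall t \near Fl, forall j, P 0 j (g t 0 j).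
  by apply: filter_forall => j; exact: h.
apply: filterS => t Pt; apply: PA => i j; rewrite (ord1 i); exact: Pt.
Qed.

(** If all Taylor coefficients of F vanish, then F (gamma t) is smaller than every
    remainder; if the first m vanish, then F (gamma t) differs from the term of
    degree m by the remainder of order m + 1. *)
Lemma flow_line_germ n (a : 'I_n -> mpoly n R) (z : 'rV[R]_n) :
  exists gamma : R -> 'rV[R]_n, [/\
    \forall t \near 0^', forall F,
      (forall k, peval (iter k (vfield a) F) z = 0) -> peval F (gamma t) = 0,
    (forall F m, (forall k, (k < m)%N -> peval (iter k (vfield a) F) z = 0) ->
      peval F (gamma t) / t ^+ m @[t --> 0^'] -->
        peval (iter m (vfield a) F) z / m`!%:R) &
    gamma t @[t --> 0^'] --> z].
Proof.
have [K [gamma [K0 hK]]] := flow_line a z.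
have small : \forall t \near 0^', K * `|t : R| <= 2^-1.
  have h : \forall t \near 0^', `|t : R| <= K^-1 * 2^-1.
    by apply: dnbhs0_le; rewrite mulr_gt0 ?invr_gt0.
  by apply: filterS h => t; rewrite ler_pdivlMl.
have lim F m : (forall k, (k < m)%N -> peval (iter k (vfield a) F) z = 0) ->
      peval F (gamma t) / t ^+ m @[t --> 0^'] -->
        peval (iter m (vfield a) F) z / m`!%:R.
  move=> hF; have [C [C0 hC]] := hK F; apply/cvgrPdistC_le => eps eps0.
  pose B := C * K ^+ m.+1 + 1.
  have B0 : 0 < B by rewrite ltr_wpDl // mulr_ge0 // exprn_ge0 // ltW.
  have tB : \forall t \near 0^', `|t : R| <= B^-1 * eps.
    by apply: dnbhs0_le; rewrite mulr_gt0 ?invr_gt0.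
  have tn0 : \forall t \near 0^', (t : R) != 0 by exact: nbhs_dnbhs_neq.
  apply: filterS3 small tB tn0 => t ht; rewrite ler_pdivlMl // => hB t0.
  have := hC m.+1 t ht; rewrite tpolyS /tpoly big1 => [|k _]; last first.
    by rewrite /tcoef hF // mul0r mul0r.
  rewrite add0r -/(tcoef a z m F) => h.
  have tm0 : 0 < `|t ^+ m| by rewrite normr_gt0 expf_neq0.
  rewrite -(ler_pM2r tm0) -normrM mulrBl divfK ?expf_neq0 //.
  have e : C * (K * `|t|) ^+ m.+1 = C * K ^+ m.+1 * `|t| * `|t ^+ m|.
    by rewrite exprMn normrX [`|t| ^+ _]exprS; ring.
  apply: (le_trans h); rewrite e ler_wpM2r //; apply: le_trans hB.
  by rewrite ler_wpM2r // /B lerDl.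
exists gamma; split=> //.
- apply: filterS small => t ht F hF; have [C [C0 hC]] := hK F.
  apply/eqP; rewrite -normr_le0; apply/ler_addgt0Pr => eps eps0; rewrite add0r.
  have h : (C + 1) * 2^-1 ^+ k @[k --> \oo] --> (0 : R).
    rewrite -(mulr0 (C + 1)); apply: cvgM; first exact: cvg_cst.
    by apply: cvg_expr; rewrite ger0_norm ?invr_ge0 // invf_lt1 // ltr1n.
  have : \forall k \near \oo, `|0 - (C + 1) * 2^-1 ^+ k| <= eps.
    by move/cvgrPdist_le : h; apply.
  case=> k _ /(_ k (leqnn k)); rewrite /= sub0r normrN => hk.
  have := hC k t ht; rewrite /tpoly big1 => [|i _]; last by rewrite /tcoef hF !mul0r.
  rewrite subr0 => /le_trans; apply; apply: le_trans hk.
  apply: le_trans (ler_norm _); apply: ler_pM => //.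
  + by rewrite exprn_ge0 // mulr_ge0 // ltW.
  + by rewrite lerDl.
  + by rewrite lerXn2r ?nnegrE ?invr_ge0 ?(mulr_ge0 (ltW K0)).
- apply: row_cvg => j.
  have := lim (mpolyX R (mnm1 j)) 0%N (fun k hk => False_ind _ (notF hk)).
  rewrite /= /peval mevalXU fact0 divr1; apply: cvg_trans.
  by apply: near_eq_cvg; near=> t; rewrite mevalXU expr0 divr1.
Unshelve. all: by end_near. Qed.
End Limits.

Lemma horner_cvg (R : realType) (T : Type) (Fl : set_system T) (FF : Filter Fl)
    (p : {poly R}) (f : T -> R) (l : R) :
  f t @[t --> Fl] --> l -> p.[f t] @[t --> Fl] --> p.[l].
Proof.
move=> h; rewrite horner_coef; under eq_fun do rewrite horner_coef.
by apply: sum_cvg => i; apply: cvgM; [exact: cvg_cst|exact: exp_cvg].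
Qed.

Lemma near_cst_limit (R : realType) (T : Type) (Fl : set_system T)
    (FF : ProperFilter Fl) (f : T -> R) (a b : R) :
  f t @[t --> Fl] --> a -> (\forall t \near Fl, f t = b) -> a = b.
Proof.
move=> fa fb; apply/eqP; rewrite eq_le; apply/andP; split.
  by apply: cvgr_to_le fa _; apply: filterS fb => t ->.
by apply: cvgr_to_ge fa _; apply: filterS fb => t ->.
Qed.

Lemma poly_zero_accumulation (R : realType) (T : Type) (Fl : set_system T)
    (FF : ProperFilter Fl) (p : {poly R}) (f : T -> R) :
  f t @[t --> Fl] --> 0 -> (\forall t \near Fl, f t != 0 /\ p.[f t] = 0) -> p = 0.
Proof.
move=> f0 fp; apply/eqP/negPn/negP => p0.
have [m [q qn pq]] := multiplicity_XsubC p 0.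
rewrite p0 /= in qn; case/negP: qn; rewrite rootE; apply/eqP.
have q0 : \forall t \near Fl, 0 = q.[f t].
  apply: filterS fp => t [ft0]; rewrite pq subr0 hornerM hornerXn => /eqP.
  by rewrite mulf_eq0 expf_eq0 (negbTE ft0) andbF orbF => /eqP.
apply: (near_cst_limit _ (@horner_cvg _ _ _ _ q _ _ f0)).

by apply: filterS q0 => t <-.
Qed.

(** * Gradients and transcendence degree *)

Section Substitution.
Variables (R S S' : nzRingType).

Lemma rmorph_mmap m (phi : {rmorphism S -> S'}) (f : R -> S) (h : 'I_m -> S)
    (P : mpoly m R) :
  phi (mmap f h P) = mmap (phi \o f) (phi \o h) P.
Proof.
rewrite /mmap rmorph_sum /=; apply: eq_bigr => mu _; rewrite rmorphM; congr (_ * _).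
by rewrite /mmap1 rmorph_prod; apply: eq_bigr => i _; rewrite rmorphXn.
Qed.

Lemma eq_mmap m (f f' : R -> S) (h h' : 'I_m -> S) (P : mpoly m R) :
  f =1 f' -> h =1 h' -> mmap f h P = mmap f' h' P.
Proof.
move=> ff hh; apply: eq_bigr => mu _; rewrite ff; congr (_ * _).
by apply: eq_bigr => i _; rewrite hh.
Qed.
End Substitution.

Section Concatenation.
Variables (k e : nat).

Definition fcat T (f : 'I_k -> T) (g : 'I_e -> T) (i : 'I_(k + e)) : T :=
  match split i with inl a => f a | inr b => g b end.

Lemma fcatl T (f : 'I_k -> T) (g : 'I_e -> T) a : fcat f g (lshift e a) = f a.
Proof. by rewrite /fcat (unsplitK (inl a)). Qed.

Lemma fcatr T (f : 'I_k -> T) (g : 'I_e -> T) b : fcat f g (rshift k b) = g b.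
Proof. by rewrite /fcat (unsplitK (inr b)). Qed.

Lemma fcat_ext T (f : 'I_k -> T) (g : 'I_e -> T) (h : 'I_(k + e) -> T) :
  (forall a, f a = h (lshift e a)) -> (forall b, g b = h (rshift k b)) ->
  fcat f g =1 h.
Proof. by move=> hl hr i; case: (split_ordP i) => j ->; rewrite ?fcatl ?fcatr. Qed.
End Concatenation.

Section Zariski.
Variables (R : realType) (n : nat).
Implicit Types (p q : mpoly n R) (x z : 'rV[R]_n) (V : set 'rV[R]_n).

Lemma pevalM p q x : peval (p * q) x = peval p x * peval q x.
Proof. exact: mevalM. Qed.

Lemma pevalD p q x : peval (p + q) x = peval p x + peval q x.
Proof. exact: mevalD. Qed.

Lemma pevalB p q x : peval (p - q) x = peval p x - peval q x.
Proof. exact: mevalB. Qed.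

Lemma pevalC b x : peval (mpolyC n b) x = b.
Proof. exact: mevalC. Qed.

Lemma peval0 x : peval 0 x = 0 :> R.
Proof. exact: meval0. Qed.

Lemma peval1 x : peval 1 x = 1 :> R.
Proof. exact: meval1. Qed.

Lemma peval_mmap k (y : 'I_k -> mpoly n R) (P : mpoly k R) x :
  peval (mmap (@mpolyC n R) y P) x = meval (fun i => peval (y i) x) P.
Proof.
rewrite /peval (rmorph_mmap (meval _)); apply: eq_mmap => // c /=.
by rewrite mevalC.
Qed.

Lemma vanishing_ideal_is_ideal V : is_ideal (vanishing_ideal V).
Proof.
split=> [x _|p q hp hq x Vx|a p hp x Vx]; first exact: meval0.
  by rewrite pevalD hp // hq // addr0.
by rewrite pevalM hp // mulr0.
Qed.

Lemma vanishing_idealB V p q :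
  vanishing_ideal V p -> vanishing_ideal V q -> vanishing_ideal V (p - q).
Proof. by move=> hp hq x Vx; rewrite pevalB hp // hq // subrr. Qed.

Lemma irreducible_prime V p q : irreducible V ->
  vanishing_ideal V (p * q) -> vanishing_ideal V p \/ vanishing_ideal V q.
Proof.
move=> [_ irr] pq.
have cl (r : mpoly n R) : zclosed [set x | peval r x = 0].
  by exists [set r]; apply/seteqP; split=> [x hx _ ->|x hx]; [|exact: hx].
case: (irr _ _ (cl p) (cl q)) => [x Vx|h|h]; [|left|right].
- have := pq x Vx; rewrite pevalM => /eqP; rewrite mulf_eq0 => /orP[]/eqP; by [left|right].
- by move=> x /h.
- by move=> x /h.
Qed.

Lemma not_vanishing V p : ~ vanishing_ideal V p -> exists2 x, V x & peval p x != 0.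
Proof.
move=> h; apply: contrapT => no; apply: h => x Vx; apply/eqP/negPn/negP => px.
by apply: no; exists x.
Qed.

Lemma mderiv_var (i j : 'I_n) : mderiv i (mpolyX R (mnm1 j)) = (i == j)%:R :> mpoly n R.
Proof.
rewrite mderivX mnm1E eq_sym; case: eqP => [->|_]; last by rewrite scale0r.
rewrite scale1r -(mpolyX0 n R); congr mpolyX.
by apply/mnmP => a; rewrite mnmBE subnn mnm0E.
Qed.

Definition on_line z (w : 'rV[R]_n) : mpoly n R -> {poly R} :=
  mmap (@polyC R) (fun i => (z 0 i)%:P + w 0 i *: 'X).

HB.instance Definition _ z w := GRing.RMorphism.on (on_line z w).

Lemma on_line0 z w p : (on_line z w p).[0] = peval p z.
Proof.
rewrite -[LHS]/(horner_eval 0 _) (rmorph_mmap (horner_eval (0 : R))).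
apply: eq_mmap => [c|i] /=; rewrite /horner_eval ?hornerC //.
by rewrite hornerD hornerZ hornerX mulr0 addr0 hornerC.
Qed.

Lemma on_line1 z w p :
  (on_line z w p)^`().[0] = \sum_i w 0 i * peval (mderiv i p) z.
Proof.
elim/mpoly_ring_ind: p => [c|j|F G IF IG|F G IF IG].
- rewrite /on_line mmapC derivC horner0 big1 // => i _.
  by rewrite mderivC /peval meval0 mulr0.
- rewrite /on_line mmapX mmap1U derivD derivC derivZ derivX add0r hornerZ hornerC.
  rewrite mulr1 (bigD1 j) //= big1 => [|i ne].
    by rewrite mderiv_var eqxx peval1 mulr1 addr0.
  by rewrite mderiv_var (negbTE ne) peval0 mulr0.
- rewrite rmorphD derivD hornerD IF IG -big_split /=; apply: eq_bigr => i _.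
  by rewrite mderivD pevalD mulrDr.
- rewrite rmorphM derivM hornerD !hornerM !on_line0 IF IG mulr_suml mulr_sumr.
  by rewrite -big_split /=; apply: eq_bigr => i _; rewrite mderivM pevalD !pevalM; ring.
Qed.

(** Equations G with independent gradients cut the transcendence degree of V down
    to n - e. Indeed, expand a polynomial relation between y and G along a line
    through a point z of V: there G j vanishes to first order, with an
    arbitrarily prescribed derivative omega j, so that the part of lowest degree
    of the relation in its second group of variables vanishes at (y z, omega).
    Its coefficients are relations between the y i alone. *)
Lemma dependent_of_independent_gradients V e (G : 'I_e -> mpoly n R) (b : mpoly n R) :
  irreducible V -> (forall j, vanishing_ideal V (G j)) -> ~ vanishing_ideal V b ->
  (forall z, V z -> peval b z != 0 -> forall omega : 'I_e -> R,
     exists w : 'rV[R]_n, forall j,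
       \sum_i w 0 i * peval (mderiv i (G j)) z = omega j) ->
  forall k (y : 'I_k -> mpoly n R), (n < k + e)%N -> ~ alg_independent V y.
Proof.
move=> irrV GV bV grad k y nke indep.
have [Phi Phi_neq0 Phi0E] := algebraically_dependent (fcat y G) nke.
pose w := fcat (fun=> 0%N : nat) (fun=> 1%N : nat) : 'I_(k + e) -> nat.
have [k0 [Phi0 [Phi0_neq0 _ initial]]] := lowest_weight_form w Phi_neq0.
have vanish z omega : V z -> peval b z != 0 ->
    meval (fcat (fun i => peval (y i) z) omega) Phi0 = 0.
  move=> Vz bz; have [v hv] := grad z Vz bz omega.
  have factor j : exists g, on_line z v (G j) = 'X * g.
    have : root (on_line z v (G j)) 0 by rewrite rootE on_line0 GV.
    by case/factor_theorem => g ->; exists g; rewrite subr0 mulrC.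
  have [g hg] := choice factor.
  have g0 j : (g j).[0] = omega j.
    rewrite -hv -on_line1 hg derivM derivX mul1r hornerD hornerM hornerX mul0r.
    by rewrite addr0.
  pose h := fcat (fun i => on_line z v (y i)) g.
  have [r] := initial _ (@polyC R) 'X h.
  have -> : mmap (@polyC R) (fun i => 'X ^+ w i * h i) Phi =
      on_line z v (mmap (@mpolyC n R) (fcat y G) Phi).
    rewrite rmorph_mmap; apply: eq_mmap => [c|i] /=.
      by rewrite /on_line mmapC.
    by case: (split_ordP i) => j ->; rewrite /h /w ?fcatl ?fcatr ?mul1r ?hg.
  rewrite Phi0E rmorph0 => /esym/eqP; rewrite mulf_eq0 expf_eq0 polyX_eq0 andbF /=.
  move/eqP/(congr1 (horner_eval 0)).
  rewrite /horner_eval hornerD hornerM hornerX mul0r addr0 horner0 => <-.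
  rewrite -[in RHS]/(horner_eval 0 _) (rmorph_mmap (horner_eval (0 : R))).
  apply: eq_mmap => [c|i] /=; rewrite /horner_eval ?hornerC //.
  by case: (split_ordP i) => j ->; rewrite /h ?fcatl ?fcatr ?on_line0 ?g0.
case/eqP: Phi0_neq0; apply: mpoly_fun_eq0 => v.
pose eta i := v (lshift e i); pose omega j := v (rshift k j).
pose A : mpoly k R := mmap (@mpolyC k R)
  (fcat (fun i => mpolyX R (mnm1 i)) (fun j => mpolyC k (omega j))) Phi0.
have AE u : meval u A = meval (fcat u omega) Phi0.
  rewrite (rmorph_mmap (meval u)); apply: eq_mmap => [c|i] /=; first by rewrite mevalC.
  by case: (split_ordP i) => j ->; rewrite ?fcatl ?fcatr ?mevalXU ?mevalC.
have A0 : A = 0.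
  apply: indep => z Vz; rewrite -peval_mmap.
  have [|//|/bV //] := @irreducible_prime V (mmap (@mpolyC n R) y A) b irrV.
    move=> x Vx; rewrite pevalM; have [->|bx] := eqVneq (peval b x) 0.
      by rewrite mulr0.
    by rewrite peval_mmap AE vanish ?mul0r.
  by move/(_ z Vz).
rewrite -(meval0 eta) -A0 AE; apply: eq_mmap => // i.
by apply/esym/fcat_ext.
Qed.
End Zariski.

(** * Local coordinates at a nonsingular point *)

Section Coordinates.
Variables (R : realType) (n : nat).

Definition gradient_mx k (u : 'I_k -> mpoly n R) (z : 'rV[R]_n) : 'M[R]_(k, n) :=
  \matrix_(i, j) peval (mderiv j (u i)) z.

Lemma mulmx_trmx_eq0 k (A : 'M[R]_(k, n)) : A *m A^T = 0 -> A = 0.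
Proof.
move=> h; apply/matrixP => i j; rewrite mxE; apply/eqP.
have /matrixP/(_ i i) := h; rewrite !mxE => /eqP.
rewrite psumr_eq0 => [|l _]; last by rewrite mxE -expr2 sqr_ge0.
by move/allP/(_ j (mem_index_enum _)); rewrite mxE -expr2 sqrf_eq0.
Qed.

(** A maximal family g of equations of X with independent gradients at z cuts out
    the tangent space. Over the reals the span of these gradients is an
    orthogonal complement of the tangent space, whence the dimension c and the
    independence of all the rows together. *)
Lemma tangent_complement (X : set 'rV[R]_n) (z : 'rV[R]_n) d : has_tangent_dim X z d ->
  exists c (g : 'I_c -> mpoly n R) (B : 'M[R]_(d, n)), [/\ n = (d + c)%N,
    (forall j, vanishing_ideal X (g j)) & row_free (col_mx B (gradient_mx g z))].
Proof.
move=> [B [Bfree BT]].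
pose ok c := exists2 g : 'I_c -> mpoly n R,
  (forall j, vanishing_ideal X (g j)) & row_free (gradient_mx g z).
have ok0 : exists c, `[< ok c >].
  exists 0%N; apply/asboolP; exists (fun=> 0); first by move=> [].
  by rewrite /row_free eqn_leq rank_leq_row.
have ok_le c : `[< ok c >] -> (c <= n)%N.
  by move/asboolP => [g _ /eqP <-]; exact: rank_leq_col.
case: (ex_maxnP ok0 ok_le) => c /asboolP[g gX gfree] cmax.
set G := gradient_mx g z in gfree.
have gradG p : vanishing_ideal X p -> (gradient_mx (fun _ : 'I_1 => p) z <= G)%MS.
  move=> pX; apply/negPn/negP => pG.
  have : `[< ok (c + 1)%N >].
    apply/asboolP; exists (fcat g (fun=> p)).
      by move=> i; case: (split_ordP i) => j ->; rewrite ?fcatl ?fcatr.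
    have -> : gradient_mx (fcat g (fun=> p)) z =
        col_mx G (gradient_mx (fun _ : 'I_1 => p) z).
      apply/matrixP => i j; rewrite !mxE.
      by case: (split_ordP i) => l ->; rewrite ?fcatl ?fcatr !mxE.
    apply: inj_row_free => v; rewrite -[v]hsubmxK mul_row_col => ab0.
    set a := lsubmx v in ab0 *; set b := rsubmx v in ab0 *.
    have b0 : b = 0.
      have b1 := mx11_scalar b.
      have [e|b0] := eqVneq (b 0 0) 0; first by rewrite b1 e raddf0.
      case/negP: pG; apply/submxP; exists (- (b 0 0)^-1 *: a).
      have /eqP : a *m G + b 0 0 *: gradient_mx (fun _ : 'I_1 => p) z = 0.
        by rewrite -mul_scalar_mx -b1.
      rewrite addr_eq0 => /eqP aG.
      by rewrite -scalemxAl aG scalerN scaleNr opprK scalerA mulVf // scale1r.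
    move/eqP: ab0; rewrite b0 mul0mx addr0 mulmx_free_eq0 // => /eqP ->.
    by rewrite row_mx0.
  by move/cmax; rewrite addn1 ltnn.
have tangentE v : zariski_tangent X z v <-> v *m G^T = 0.
  split=> [hv|vG p pX].
    apply/matrixP => i j; rewrite !mxE (ord1 i) -[RHS](hv _ (gX j)).
    by apply: eq_bigr => l _; rewrite !mxE.
  have /submxP[a ap] := gradG p pX.
  transitivity ((v *m (gradient_mx (fun _ : 'I_1 => p) z)^T) 0 0).
    by rewrite mxE; apply: eq_bigr => l _; rewrite !mxE.
  by rewrite ap trmx_mul mulmxA vG mul0mx mxE.
have BE (v : 'rV[R]_n) : (v <= B)%MS = (v *m G^T == 0).
  by apply/idP/eqP => [/BT/tangentE|/tangentE/BT].
have BG : B *m G^T = 0.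
  by apply/row_matrixP => i; rewrite row_mul row0; apply/eqP; rewrite -BE row_sub.
have rB : \rank B = (n - c)%N.
  have /eqP cG := gfree.
  rewrite -[X in (n - X)%N]cG -(mxrank_tr G) -mxrank_ker; apply/eqP.
  rewrite eqn_leq; apply/andP; split; apply: mxrankS; first exact/sub_kermxP.
  by apply/row_subP => i; rewrite BE; apply/eqP/sub_kermxP; rewrite row_sub.
have cn : (c <= n)%N by apply: ok_le; apply/asboolP; exists g.
exists c, g, B; split=> //.
  by move/eqP: Bfree => <-; rewrite rB subnK.
apply: inj_row_free => v; rewrite -[v]hsubmxK mul_row_col.
set a := lsubmx v; set b := rsubmx v => abG.
have aB0 : a *m B = 0.
  apply: mulmx_trmx_eq0.
  have -> : a *m B *m (a *m B)^T = - (a *m B *m (b *m G)^T).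
    by move/eqP: abG; rewrite addr_eq0 => /eqP {2}->; rewrite linearN mulmxN.
  by rewrite trmx_mul -mulmxA (mulmxA B) BG mul0mx mulmx0 oppr0.
move/eqP: aB0; rewrite mulmx_free_eq0 // => /eqP a0.
move/eqP: abG; rewrite a0 mul0mx add0r mulmx_free_eq0 // => /eqP b0.
by rewrite b0 row_mx0.
Qed.

(** Cramer's rule: the coordinate vector fields of the system of functions u,
    cleared of the denominator det (du). *)
Definition adjugate_field (u : 'I_n -> mpoly n R) (v : 'I_n -> R) (j : 'I_n) : mpoly n R :=
  \sum_i (\adj (\matrix_(i, j) mderiv j (u i))) j i * mpolyC n (v i).

Definition jacobian (u : 'I_n -> mpoly n R) : mpoly n R :=
  \det (\matrix_(i, j) mderiv j (u i)).

Lemma adjugate_fieldE u v i :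
  vfield (adjugate_field u v) (u i) = mpolyC n (v i) * jacobian u.
Proof.
set M := \matrix_(i, j) mderiv j (u i) : 'M[mpoly n R]_n.
have cramer l : \sum_j M i j * (\adj M) j l = (\det M) *+ (i == l).
  by have /matrixP/(_ i l) := mul_mx_adj M; rewrite !mxE.
rewrite /vfield /adjugate_field -/M.
under eq_bigr do rewrite mulr_suml.
rewrite exchange_big /= (bigD1 i) //= [X in _ + X]big1 => [|l ne].
  have := cramer i; rewrite eqxx mulr1n => {}cramer.
  rewrite addr0 /jacobian -/M -cramer mulr_sumr.
  by apply: eq_bigr => j _; rewrite !mxE; ring.
transitivity (mpolyC n (v l) * \sum_j M i j * (\adj M) j l).
  by rewrite mulr_sumr; apply: eq_bigr => j _; rewrite [M i j]mxE; ring.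
by rewrite cramer eq_sym (negbTE ne) mulr0.
Qed.

Lemma peval_vfield (a : 'I_n -> mpoly n R) F z :
  peval (vfield a F) z = \sum_i peval (a i) z * peval (mderiv i F) z.
Proof. rewrite /peval raddf_sum; apply: eq_bigr => i _; exact: mevalM. Qed.

Lemma independent_gradients u z (omega : 'I_n -> R) : peval (jacobian u) z != 0 ->
  exists w : 'rV[R]_n, forall j,
    \sum_i w 0 i * peval (mderiv i (u j)) z = omega j.
Proof.
move=> Jz; pose v j := omega j / peval (jacobian u) z.
exists (\row_i peval (adjugate_field u v i) z) => j.
under eq_bigr do rewrite mxE.
by rewrite -peval_vfield adjugate_fieldE pevalM /peval mevalC divfK.
Qed.

Lemma jacobian_neq0 u z : row_free (gradient_mx u z) -> peval (jacobian u) z != 0.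
Proof.
rewrite row_free_unit unitmxE unitfE; congr (_ != 0).
rewrite /jacobian /peval -(det_map_mx (meval _)); congr (\det _).
by apply/matrixP => i j; rewrite !mxE.
Qed.
End Coordinates.

(** * Vector fields tangent to a component *)

Section Stability.
Variables (R : realType) (d c : nat).
Local Notation n := (d + c)%N.
Variables (V : set 'rV[R]_n) (z : 'rV[R]_n) (l : 'I_d -> mpoly n R) (g : 'I_c -> mpoly n R).
Hypotheses (irrV : irreducible V) (dimV : has_dim V d) (Vz : V z).
Hypotheses (gV : forall j, vanishing_ideal V (g j)).
Hypothesis Jz : peval (jacobian (fcat l g)) z != 0.

Definition tangent_field (v : 'I_d -> R) := adjugate_field (fcat l g) (fcat v (fun=> 0)).

Lemma tangent_field_l v i :
  vfield (tangent_field v) (l i) = mpolyC n (v i) * jacobian (fcat l g).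
Proof. by rewrite -(fcatl l g) adjugate_fieldE fcatl. Qed.

Lemma tangent_field_g v j : vfield (tangent_field v) (g j) = 0.
Proof. by rewrite -(fcatr l g) adjugate_fieldE fcatr mpolyC0 mul0r. Qed.

(** If some h in the ideal of V were not tangent to the field, then h and the
    g j would have independent gradients at a point of V, and V would have
    dimension less than d. *)
Lemma tangent_field_stable v h :
  vanishing_ideal V h -> vanishing_ideal V (vfield (tangent_field v) h).
Proof.
move=> hV; apply: contrapT => nDh; set D := vfield _ in nDh.
have [[y yindep] _] := dimV.
pose G := fcat g (fun _ : 'I_1 => h).
have GV j : vanishing_ideal V (G j).
  by rewrite /G; case: (split_ordP j) => i ->; rewrite ?fcatl ?fcatr.
have bV : ~ vanishing_ideal V (jacobian (fcat l g) * D h).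
  move=> /(irreducible_prime irrV)[JV|//]; move/eqP: Jz; apply; exact: JV.
apply: (dependent_of_independent_gradients irrV GV bV _ _ yindep); last by rewrite addn1 addnS ltnS.
move=> x Vx; rewrite pevalM mulf_eq0 negb_or => /andP[Jx Dhx] omega.
have [w0 hw0] := independent_gradients (fcat (fun=> 0) (fun j => omega (lshift 1 j))) Jx.
pose alpha := (omega (rshift c 0) - \sum_i w0 0 i * peval (mderiv i h) x) / peval (D h) x.
exists (\row_i (w0 0 i + alpha * peval (tangent_field v i) x)) => j.
have -> : \sum_i (\row_i (w0 0 i + alpha * peval (tangent_field v i) x)) 0 i *
     peval (mderiv i (G j)) x = \sum_i w0 0 i * peval (mderiv i (G j)) x +
       alpha * peval (D (G j)) x.
  rewrite peval_vfield mulr_sumr -big_split /=; apply: eq_bigr => i _.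
  by rewrite mxE; ring.
rewrite /G; case: (split_ordP j) => i ->; rewrite ?fcatl ?fcatr.
  have := hw0 (rshift d i); rewrite !fcatr => ->.
  by rewrite /D tangent_field_g /peval meval0 mulr0 addr0.
by rewrite (ord1 i) /alpha divfK // addrC subrK.
Qed.

Lemma tangent_field_iter_stable v h k :
  vanishing_ideal V h -> vanishing_ideal V (iter k (vfield (tangent_field v)) h).
Proof. by move=> hV; elim: k => // k; exact: tangent_field_stable. Qed.

(** All iterated derivatives of a polynomial of the ideal of V belong to this
    ideal, hence vanish at x: the flow line through x stays in the Zariski
    closure of V. *)
Lemma tangent_flow_line v x : V x -> exists gamma : R -> 'rV[R]_n, [/\
    \forall t \near 0^', forall h, vanishing_ideal V h -> peval h (gamma t) = 0,
    (forall F m,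
      (forall k, (k < m)%N -> peval (iter k (vfield (tangent_field v)) F) x = 0) ->
      peval F (gamma t) / t ^+ m @[t --> 0^'] -->
        peval (iter m (vfield (tangent_field v)) F) x / m`!%:R),
    gamma t @[t --> 0^'] --> x &
    \forall t \near 0^', forall F,
      (forall k, peval (iter k (vfield (tangent_field v)) F) x = 0) ->
      peval F (gamma t) = 0].
Proof.
move=> Vx; have [gamma [flat lim cvg_x]] := flow_line_germ (tangent_field v) x.
exists gamma; split=> //; apply: filterS flat => t flat h hV.
by apply: flat => k; exact: (tangent_field_iter_stable v k hV).
Qed.
End Stability.

(** * Transversality of the flow lines *)

Section Transversality.
Variables (R : realType) (d c : nat).
Local Notation n := (d + c)%N.
Variables (V : set 'rV[R]_n) (z : 'rV[R]_n) (l : 'I_d -> mpoly n R) (g : 'I_c -> mpoly n R).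
Hypotheses (irrV : irreducible V) (dimV : has_dim V d) (Vz : V z).
Hypotheses (gV : forall j, vanishing_ideal V (g j)).
Hypothesis Jz : peval (jacobian (fcat l g)) z != 0.
Local Notation D v := (vfield (tangent_field l g v)).

Lemma irreducible_prime_exp (W : set 'rV[R]_n) q p k : irreducible W ->
  ~ vanishing_ideal W q -> vanishing_ideal W (q ^+ k * p) -> vanishing_ideal W p.
Proof.
move=> irrW qW; elim: k => [|k IH]; first by rewrite expr0 mul1r.
by rewrite exprS -mulrA => /(irreducible_prime irrW)[|/IH].
Qed.

(** The functions l and q satisfy an algebraic relation on V, because V has
    dimension d. If q vanished on the flow lines through z, so would the part of
    lowest degree in q of this relation, a nonzero polynomial in l alone; but the
    flow lines through z project by l onto all the lines through l z. *)
Lemma transversal_field q : ~ vanishing_ideal V q ->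
  exists v k, peval (iter k (D v) q) z != 0.
Proof.
move=> qV; apply: contrapT => no.
have flat v k : peval (iter k (D v) q) z = 0.
  by apply/eqP/negPn/negP => h; apply: no; exists v, k.
have [A [AV A_neq0]] : exists A : mpoly (d + 1) R,
    (forall x, V x -> meval (fun j => peval (fcat l (fun=> q) j) x) A = 0) /\ A != 0.
  apply: contrapT => h; have [_ /(_ (d + 1)%N (fcat l (fun _ : 'I_1 => q)))] := dimV.
  move=> dep; suff ind : alg_independent V (fcat l (fun _ : 'I_1 => q)).
    by have := dep ind; rewrite addn1 ltnn.
  move=> A hA; apply/eqP/negPn/negP => A0.
  by apply: h; exists A.
pose w := fcat (fun=> 0%N : nat) (fun=> 1%N : nat) : 'I_(d + 1) -> nat.
have [k0 [A0 [A0_neq0 homog initial]]] := lowest_weight_form w A_neq0.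
pose h : 'I_(d + 1) -> mpoly n R := fcat l (fun=> 1).
have [r hr] := initial _ (@mpolyC n R) q h.
set F := mmap _ h A0 + q * r in hr.
have FV : vanishing_ideal V F.
  apply: (@irreducible_prime_exp V q F k0 irrV qV); rewrite -hr => x Vx.
  rewrite peval_mmap -[RHS](AV x Vx); apply: eq_mmap => // i.
  by case: (split_ordP i) => j ->; rewrite /h /w ?fcatl ?fcatr ?mul1r ?mulr1.
have A01 (Y : 'I_d -> R) : meval (fcat Y (fun=> 1)) A0 = 0.
  pose v j := Y j - peval (l j) z.
  pose C : {poly R} := mmap (@polyC R)
    (fcat (fun j => (peval (l j) z)%:P + v j *: 'X) (fun=> 1)) A0.
  have CE s : C.[s] = meval (fcat (fun j => peval (l j) z + s * v j) (fun=> 1)) A0.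
    rewrite -[LHS]/(horner_eval s _) (rmorph_mmap (horner_eval s)).
    apply: eq_mmap => [b|i] /=; rewrite /horner_eval ?hornerC //.
    case: (split_ordP i) => j ->; rewrite ?fcatl ?fcatr ?hornerC //.
    by rewrite hornerD hornerZ hornerX hornerC mulrC.
  have line x (s : R) : peval F x = 0 -> peval q x = 0 ->
     (forall j, peval (l j) x = peval (l j) z + s * v j) -> C.[s] = 0.
    rewrite /F pevalD pevalM => Fx qx lx; rewrite qx mul0r addr0 in Fx.
    rewrite CE -[RHS]Fx peval_mmap; apply: eq_mmap => // i.
    case: (split_ordP i) => j ->; rewrite /h ?fcatl ?fcatr ?lx //.
    by rewrite /peval meval1.
  suff C0 : C.[1] = 0.
    rewrite -C0 CE; apply: eq_mmap => // i.
    by case: (split_ordP i) => j ->; rewrite ?fcatl ?fcatr // /v mul1r addrC subrK.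
  (* C is the restriction of that polynomial in l to the line through l z and Y. *)
  have [[j vj]|v0] := pselect (exists j, v j != 0); last first.
    apply: (line z) => // [||j]; [exact: FV|exact: (flat v 0%N)|].
    have -> : v j = 0 by apply/eqP/negPn/negP => vj; apply: v0; exists j.
    by rewrite mulr0 addr0.
  have [gamma [gV0 lim _ gflat]] := tangent_flow_line irrV dimV Vz gV Jz v Vz.
  pose L i : mpoly n R := l i - mpolyC n (peval (l i) z).
  have LE i x : peval (L i) x = peval (l i) x - peval (l i) z.
    by rewrite /peval mevalB mevalC.
  have DL i : D v (L i) = mpolyC n (v i) * jacobian (fcat l g).
    by rewrite vfieldB vfieldC subr0 tangent_field_l.
  (* The position on that line at time t; it moves since its derivative is the
     nonzero Jacobian. *)
  pose s t := peval (L j) (gamma t) / v j.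
  have sJ : s t / t @[t --> 0^'] --> peval (jacobian (fcat l g)) z.
    have := lim (L j) 1%N; rewrite /= DL pevalM pevalC -[1`!]/1%N divr1 => hL.
    have {}hL : peval (L j) (gamma t) / t @[t --> 0^'] -->
        v j * peval (jacobian (fcat l g)) z.
      apply: hL => -[|//] _; by rewrite /= LE subrr.
    rewrite (_ : peval _ z = v j * peval (jacobian (fcat l g)) z * (v j)^-1).
      rewrite (_ : (fun t => _) = (fun t => peval (L j) (gamma t) / t * (v j)^-1)).
        by apply: cvgM => //; exact: cvg_cst.
      by apply/funext => t; rewrite /s mulrAC.
    by rewrite mulrAC divff ?mul1r.
  have t0 : t @[t --> 0^'] --> (0 : R) by exact: cvg_within.
  have tn0 : \forall t \near 0^', (t : R) != 0 by exact: nbhs_dnbhs_neq.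
  have sT : s t @[t --> 0^'] --> 0.
    have h0 := cvgM (FF := dnbhs_filter _) sJ t0; rewrite mulr0 in h0; apply: (near_eq_limit _ h0).
    by apply: filterS tn0 => t tn; rewrite /= divfK.
  have C0 : C = 0.
    apply: (@poly_zero_accumulation _ _ _ _ C s sT).
    have sn0 : \forall t \near 0^', s t / t != 0.
      by apply: cvgr_neq0 sJ _; exact: Jz.
    apply: filterS3 (filterI gV0 gflat) tn0 sn0 => t [gV1 gf] _ st0; split.
      by apply: contra_neq st0 => ->; rewrite mul0r.
    apply: (line (gamma t)); [exact: gV1|exact: gf|move=> i].
    have flatL : peval (v j *: L i - v i *: L j) (gamma t) = 0.
      apply: gf => k; case: k => [|k].
        by rewrite /= -!mul_mpolyC pevalB !pevalM !LE !subrr !mulr0 subrr.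
      rewrite iterSr vfieldB !vfieldZ !DL -!mul_mpolyC [X in X - _]mulrCA subrr.
      suff -> : iter k (D v) 0 = 0 by exact: peval0.
      by elim: k => //= k ->; exact: vfield0.
    have : v j * peval (L i) (gamma t) = v i * peval (L j) (gamma t).
      by move: flatL; rewrite -!mul_mpolyC pevalB !pevalM !pevalC => /eqP; rewrite subr_eq0 => /eqP.
    move=> e; rewrite -[LHS](subrK (peval (l i) z)) -LE addrC; congr (_ + _).
    by apply: (mulfI vj); rewrite e /s; field.
  by rewrite C0 horner0.
case/eqP: A0_neq0; apply: mpoly_fun_eq0 => eta.
pose Y j := eta (lshift 1 j); pose tau := eta (rshift d 0).
have := homog _ idfun tau (fcat Y (fun=> 1)).
rewrite -/(meval _ A0) -/(meval _ A0) A01 mulr0 => <-; apply: eq_mmap => // i.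
case: (split_ordP i) => j ->; rewrite /w ?fcatl ?fcatr ?mul1r ?mulr1 //.
by rewrite (ord1 j).
Unshelve. all: by end_near. Qed.
End Transversality.

(** * Local irreducibility at a nonsingular point *)

Section MaximalIdealPowers.
Variables (R : realType) (n : nat) (z : 'rV[R]_n).
Implicit Types (r : mpoly n R) (P : mpoly (n + n) R).

Definition shifted_coord (i : 'I_n) : mpoly n R := mpolyX R (mnm1 i) - mpolyC n (z 0 i).

(** A presentation of the Rees algebra of the maximal ideal m at z: the variable
    'X marks the degree in the shifted coordinates, so that the coefficient of
    degree k of an element of the image lies in m ^ k. *)
Definition rees : mpoly (n + n) R -> {poly mpoly n R} :=
  mmap (polyC \o @mpolyC n R)
    (fcat (fun i => (mpolyX R (mnm1 i))%:P) (fun i => shifted_coord i *: 'X)).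

HB.instance Definition _ := GRing.RMorphism.on rees.

(** Membership in m ^ k. *)
Definition max_pow (k : nat) r := exists P, rees P = r%:P * 'X^k.

Lemma max_powD k r r' : max_pow k r -> max_pow k r' -> max_pow k (r + r').
Proof. by move=> [P e] [P' e']; exists (P + P'); rewrite rmorphD /= e e' polyCD mulrDl. Qed.

Lemma max_powM k k' r r' : max_pow k r -> max_pow k' r' -> max_pow (k + k') (r * r').
Proof.
move=> [P e] [P' e']; exists (P * P'); rewrite rmorphM /= e e' polyCM exprD.
by rewrite mulrACA.
Qed.

Lemma max_pow0 r : max_pow 0 r.
Proof.
exists (mmap (@mpolyC _ R) (fun i => mpolyX R (mnm1 (lshift n i))) r).
rewrite expr0 mulr1 (rmorph_mmap rees).
elim/mpoly_ring_ind: r => [b|i|F G IF IG|F G IF IG].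
- by rewrite mmapC /= /rees mmapC.
- by rewrite mmapX mmap1U /= /rees mmapX mmap1U fcatl.
- by rewrite raddfD /= IF IG polyCD.
- by rewrite rmorphM /= IF IG polyCM.
Qed.

Lemma max_powMl k r r' : max_pow k r' -> max_pow k (r * r').
Proof. by move=> h; rewrite -[k]add0n; apply: max_powM h; exact: max_pow0. Qed.

Lemma max_pow_zero k : max_pow k 0.
Proof. by exists 0; rewrite rmorph0 polyC0 mul0r. Qed.

Lemma max_pow_sum k (I : Type) (s : seq I) (r : I -> mpoly n R) :
  (forall i, max_pow k (r i)) -> max_pow k (\sum_(i <- s) r i).
Proof.
move=> h; apply: (big_ind (max_pow k)) => [||i _]; last exact: h.
  exact: max_pow_zero.
exact: max_powD.
Qed.

Lemma max_pow1 i : max_pow 1 (shifted_coord i).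
Proof.
exists (mpolyX R (mnm1 (rshift n i))); rewrite /rees mmapX mmap1U fcatr expr1.
by rewrite mul_polyC.
Qed.

Lemma rees_coef0 P k : (0 < k)%N -> peval (rees P)`_k z = 0.
Proof.
move=> k0; rewrite -[LHS](coef_map (meval (fun i => z 0 i))) /=.
have -> : map_poly (meval (fun i => z 0 i)) (rees P) =
    (meval (fcat (fun i => z 0 i) (fun=> 0)) P)%:P; last by rewrite coefC gtn_eqF.
rewrite (rmorph_mmap (map_poly (meval (fun i => z 0 i)))) (rmorph_mmap (@polyC R)).
apply: eq_mmap => [b|i] /=; first by rewrite map_polyC /= mevalC.
case: (split_ordP i) => j ->; rewrite ?fcatl ?fcatr ?map_polyC /= ?mevalXU //.
by rewrite map_polyZ map_polyX /= /shifted_coord mevalB mevalXU mevalC subrr scale0r polyC0.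
Qed.

Lemma rees_coef P k : max_pow k (rees P)`_k.
Proof.
elim/mpoly_ring_ind: P k => [b|i|F G IF IG|F G IF IG] k.
- rewrite /rees mmapC /= coefC; case: eqP => [->|_]; [exact: max_pow0|exact: max_pow_zero].
- rewrite /rees mmapX mmap1U; case: (split_ordP i) => j ->; rewrite ?fcatl ?fcatr.
    by rewrite coefC; case: eqP => [->|_]; [exact: max_pow0|exact: max_pow_zero].
  rewrite coefZ coefX; case: eqP => [->|_]; first by rewrite mulr1; exact: max_pow1.
  by rewrite mulr0; exact: max_pow_zero.
- by rewrite rmorphD coefD; exact: (max_powD (IF k) (IG k)).
- rewrite rmorphM coefM; apply: max_pow_sum => j.
  by rewrite -[X in max_pow X](subnKC (ltn_ord j : j <= k)%N); exact: (max_powM (IF _) (IG _)).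
Qed.

Lemma max_pow1_eval r : max_pow 1 (r - mpolyC n (peval r z)).
Proof.
elim/mpoly_ring_ind: r => [b|i|F G IF IG|F G IF IG].
- by rewrite pevalC subrr; exact: max_pow_zero.
- by rewrite /peval mevalXU; exact: max_pow1.
- rewrite pevalD mpolyCD opprD addrACA; exact: (max_powD IF IG).
- have -> : F * G - mpolyC n (peval (F * G) z) =
     G * (F - mpolyC n (peval F z)) + mpolyC n (peval F z) * (G - mpolyC n (peval G z)).
    by rewrite pevalM mpolyCM; ring.
  exact: (max_powD (max_powMl _ IF) (max_powMl _ IG)).
Qed.

Lemma max_pow2_taylor r : max_pow 2 (r - mpolyC n (peval r z) -
  \sum_i mpolyC n (peval (mderiv i r) z) * shifted_coord i).
Proof.
elim/mpoly_ring_ind: r => [b|j|F G IF IG|F G IF IG].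
- rewrite pevalC subrr sub0r big1 ?oppr0 => [|i _]; first exact: max_pow_zero.
  by rewrite mderivC peval0 mpolyC0 mul0r.
- rewrite (bigD1 j) //= big1 => [|i ne]; last first.
    by rewrite mderiv_var (negbTE ne) peval0 mpolyC0 mul0r.
  rewrite mderiv_var eqxx.
  rewrite peval1 mpolyC1 mul1r addr0 /peval mevalXU -/(shifted_coord j) subrr.
  exact: max_pow_zero.
- have -> : F + G - mpolyC n (peval (F + G) z) -
     \sum_i mpolyC n (peval (mderiv i (F + G)) z) * shifted_coord i =
    (F - mpolyC n (peval F z) - \sum_i mpolyC n (peval (mderiv i F) z) * shifted_coord i) +
    (G - mpolyC n (peval G z) - \sum_i mpolyC n (peval (mderiv i G) z) * shifted_coord i).
    under eq_bigr do rewrite mderivD pevalD mpolyCD mulrDl.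
    by rewrite big_split /= pevalD mpolyCD; ring.
  exact: (max_powD IF IG).
- set LF := \sum_i _ * _ in IF; set LG := \sum_i _ * _ in IG.
  have -> : F * G - mpolyC n (peval (F * G) z) -
     \sum_i mpolyC n (peval (mderiv i (F * G)) z) * shifted_coord i =
    mpolyC n (peval G z) * (F - mpolyC n (peval F z) - LF) +
    mpolyC n (peval F z) * (G - mpolyC n (peval G z) - LG) +
    (F - mpolyC n (peval F z)) * (G - mpolyC n (peval G z)).
    have -> : \sum_i mpolyC n (peval (mderiv i (F * G)) z) * shifted_coord i =
        mpolyC n (peval G z) * LF + mpolyC n (peval F z) * LG.
      rewrite !mulr_sumr -big_split /=; apply: eq_bigr => i _.
      by rewrite mderivM pevalD !pevalM mpolyCD !mpolyCM; ring.
    by rewrite pevalM mpolyCM; ring.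
  apply: max_powD; last exact: (max_powM (max_pow1_eval F) (max_pow1_eval G)).
  exact: (max_powD (max_powMl _ IF) (max_powMl _ IG)).
Qed.

(** Krull's intersection theorem, by Herstein's argument. Lift the classes of
    degree k of h in the Rees algebra modulo I to a polynomial ring; by the basis
    theorem one lift is a combination of the previous ones, and comparing degrees
    shows that its coefficients may be taken in m, so that h belongs to m h modulo
    I. *)
Lemma krull_intersection (I : set (mpoly n R)) h : is_ideal I ->
  (forall k, exists2 f, I f & max_pow k (h - f)) ->
  exists2 s, peval s z != 0 & I (s * h).
Proof.
move=> [I0 ID IM] hk.
have /choice[fP hfP] k : exists fP : mpoly n R * mpoly (n + n) R,
    I fP.1 /\ rees fP.2 = (h - fP.1)%:P * 'X^k.
  by have [f If [P e]] := hk k; exists (f, P).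
have [N [b]] := hilbert_basis_sequence (fun k => (fP k).2).
move=> /(congr1 rees); rewrite (proj2 (hfP N)) rmorph_sum /=.
move=> /(congr1 (fun q : {poly mpoly n R} => q`_N)).
rewrite coefCM coefXn eqxx mulr1 coef_sum => e.
pose a i := (rees (b i))`_(N - i).
have {}e : h - (fP N).1 = \sum_(i < N) a i * (h - (fP i).1).
  rewrite e; apply: eq_bigr => i _; rewrite rmorphM /= (proj2 (hfP i)).
  rewrite mulrA coefMXn ltnNge ltnW //= mulrC coefCM mulrC; congr (_ * _).
exists (1 - \sum_(i < N) a i).
  have a0 : peval (\sum_(i < N) a i) z = 0.
    rewrite /peval raddf_sum big1 // => i _.
    by apply: rees_coef0; rewrite subn_gt0.
  by rewrite pevalB peval1 a0 subr0 oner_neq0.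
have -> : (1 - \sum_(i < N) a i) * h = (fP N).1 + \sum_(i < N) (- a i) * (fP i).1.
  apply/eqP; rewrite mulrBl mul1r subr_eq mulr_suml -addrA -big_split /= -subr_eq0.
  rewrite opprD addrA e subr_eq0; apply/eqP; apply: eq_bigr => i _; ring.
apply: (ID); first exact: (proj1 (hfP N)).
apply: (big_ind I) => [//||i _]; [exact: ID|].
by apply: IM; exact: (proj1 (hfP i)).
Qed.
End MaximalIdealPowers.

Section Krull.
Variables (R : realType) (d c : nat).
Local Notation n := (d + c)%N.
Variables (X V : set 'rV[R]_n) (z : 'rV[R]_n).
Variables (l : 'I_d -> mpoly n R) (g : 'I_c -> mpoly n R).
Hypotheses (irrV : irreducible V) (dimV : has_dim V d) (Vz : V z) (VX : V `<=` X).
Hypothesis gX : forall j, vanishing_ideal X (g j).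
Hypothesis Jz : peval (jacobian (fcat l g)) z != 0.

Let u := fcat l g.
Let xi := shifted_coord z.
Let M : 'M[R]_n := gradient_mx u z.

Let sub_ideal h : vanishing_ideal X h -> vanishing_ideal V h.
Proof. by move=> hX x /VX; exact: hX. Qed.

Let gV j : vanishing_ideal V (g j).
Proof. exact: sub_ideal. Qed.

Let M_unit : M \in unitmx.
Proof.
rewrite unitmxE unitfE; suff -> : \det M = peval (jacobian u) z by [].
rewrite /jacobian /peval -(det_map_mx (meval _)); congr (\det _).
by apply/matrixP => i j; rewrite !mxE.
Qed.

(** The components of the projection onto the tangent space of V at z parallel to
    the kernel of the gradients of the l i. *)
Let proj_xi (i : 'I_n) : mpoly n R :=
  \sum_(a < d) \sum_(j < n)
     mpolyC n ((invmx M) i (lshift c a) * M (lshift c a) j) * xi j.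

(** Differs from [rees] in that the base point is frozen at z and the direction
    is projected onto the tangent space. *)
Let tangent_part : mpoly (n + n) R -> {poly mpoly n R} :=
  mmap (polyC \o @mpolyC n R)
    (fcat (fun i => (mpolyC n (z 0 i))%:P) (fun i => proj_xi i *: 'X)).

HB.instance Definition _ := GRing.RMorphism.on tangent_part.

(** Modulo the ideal of X, the shifted coordinates coincide to first order with
    their tangential parts, since the normal parts are the linear parts of the
    g j. *)
Let xi_tangent i : exists2 f, vanishing_ideal X f & max_pow z 2 (xi i - proj_xi i - f).
Proof.
exists (\sum_(b < c) mpolyC n ((invmx M) i (rshift d b)) * g b).
  move=> x Xx; rewrite /peval raddf_sum big1 // => b _.
  by rewrite /= -/(peval _ x) pevalM gX // mulr0.
have -> : xi i - proj_xi i = \sum_(b < c) mpolyC n ((invmx M) i (rshift d b)) *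
    \sum_j mpolyC n (M (rshift d b) j) * xi j.
  have -> : xi i = \sum_(k < n) \sum_(j < n) mpolyC n ((invmx M) i k * M k j) * xi j.
    rewrite exchange_big /= (bigD1 i) //= [X in _ = _ + X]big1 => [|j ne].
      rewrite addr0 -mulr_suml -(raddf_sum (@mpolyC n R)).
      have /matrixP/(_ i i) := mulVmx M_unit; rewrite !mxE eqxx mulr1n => ->.
      by rewrite /= mpolyC1 mul1r.
    rewrite -mulr_suml -(raddf_sum (@mpolyC n R)).
    have /matrixP/(_ i j) := mulVmx M_unit; rewrite !mxE eq_sym (negbTE ne) mulr0n => ->.
    by rewrite /= mpolyC0 mul0r.
  rewrite big_split_ord /= addrAC subrr add0r; apply: eq_bigr => b _.
  by rewrite mulr_sumr; apply: eq_bigr => j _; rewrite mpolyCM mulrA.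
rewrite -sumrB; apply: max_pow_sum => b; rewrite -mulrBr; apply: max_powMl.
have := max_pow2_taylor z (g b); rewrite (gV b Vz) mpolyC0 subr0.
have -> : g b - \sum_i0 mpolyC n (peval (mderiv i0 (g b)) z) * shifted_coord z i0 =
   - (\sum_j mpolyC n (M (rshift d b) j) * xi j - g b).
  by rewrite opprB; congr (_ - _); apply: eq_bigr => j _; rewrite mxE /u fcatr.
by move/(max_powMl (-1)); rewrite mulN1r opprK.
Qed.

Let near_ideal k (q : mpoly n R) := exists2 f, vanishing_ideal X f & max_pow z k (q - f).

Let near_ideal_pow k q : max_pow z k q -> near_ideal k q.
Proof. by move=> h; exists 0; [move=> x _; exact: peval0|rewrite subr0]. Qed.

Let near_idealD k p q : near_ideal k p -> near_ideal k q -> near_ideal k (p + q).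
Proof.
move=> [f fX hf] [f' f'X hf']; exists (f + f').
  by move=> x Xx; rewrite pevalD fX // f'X // addr0.
by rewrite opprD addrACA; exact: (max_powD hf hf').
Qed.

Let near_idealM i j p q : max_pow z i p -> near_ideal j q -> near_ideal (i + j) (p * q).
Proof.
move=> hp [f fX hf]; exists (p * f); first by move=> x Xx; rewrite pevalM fX // mulr0.
by rewrite -mulrBr; exact: (max_powM hp hf).
Qed.

Let tangent_coef P k : max_pow z k (tangent_part P)`_k.
Proof.
elim/mpoly_ring_ind: P k => [b|i|F G IF IG|F G IF IG] k.
- rewrite /tangent_part mmapC /= coefC.
  by case: eqP => [->|_]; [exact: max_pow0|exact: max_pow_zero].
- rewrite /tangent_part mmapX mmap1U; case: (split_ordP i) => j ->; rewrite ?fcatl ?fcatr.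
    by rewrite coefC; case: eqP => [->|_]; [exact: max_pow0|exact: max_pow_zero].
  rewrite coefZ coefX; case: eqP => [->|_]; last by rewrite mulr0; exact: max_pow_zero.
  rewrite mulr1; apply: max_pow_sum => a; apply: max_pow_sum => b.
  by apply: max_powMl; exact: max_pow1.
- by rewrite rmorphD coefD; exact: (max_powD (IF k) (IG k)).
- rewrite rmorphM coefM; apply: max_pow_sum => j.
  by rewrite -[X in max_pow _ X](subnKC (ltn_ord j : j <= k)%N); exact: (max_powM (IF _) (IG _)).
Qed.

(** For the two groups of variables this is the definition of m and [xi_tangent];
    the claim is additive and multiplicative in P. *)
Let rees_tangent_part P k : near_ideal k.+1 ((rees z P)`_k - (tangent_part P)`_k).
Proof.
have near0 j : near_ideal j 0 by apply: near_ideal_pow; exact: max_pow_zero.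
elim/mpoly_ring_ind: P k => [b|i|F G IF IG|F G IF IG] k.
- by rewrite /rees /tangent_part !mmapC subrr.
- rewrite /rees /tangent_part !mmapX !mmap1U.
  case: (split_ordP i) => j ->; rewrite ?fcatl ?fcatr.
    rewrite -coefB -polyCB coefC; case: eqP => [->|_]; last exact: near0.
    by apply: near_ideal_pow; exact: max_pow1.
  rewrite -coefB -scalerBl coefZ coefX; case: eqP => [->|_]; last first.
    by rewrite mulr0; exact: near0.
  by rewrite mulr1; exact: xi_tangent.
- by rewrite !rmorphD !coefD opprD addrACA; exact: (near_idealD (IF k) (IG k)).
- rewrite !rmorphM !coefM -sumrB; apply: (big_ind (near_ideal k.+1)) => [//||j _].
    exact: near_idealD.
  have split_diff (a b a' b' : mpoly n R) :
    a * b - a' * b' = a * (b - b') + b' * (a - a') by ring.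
  rewrite split_diff.
  have jk : (j <= k)%N by rewrite -ltnS.
  apply: near_idealD.
    have := near_idealM (rees_coef z F j) (IG (k - j)%N).
    by rewrite addnS subnKC.
  have := near_idealM (tangent_coef G (k - j)) (IF j).
  by rewrite addnS subnK.
Qed.

Let xi_eval i (x : 'rV[R]_n) : peval (xi i) x = x 0 i - z 0 i.
Proof. by rewrite pevalB pevalC /peval mevalXU. Qed.

Let rees_eval P (x : 'rV[R]_n) s :
  (map_poly (meval (fun i => x 0 i)) (rees z P)).[s] =
  meval (fcat (fun i => x 0 i) (fun i => (x 0 i - z 0 i) * s)) P.
Proof.
rewrite (rmorph_mmap (map_poly (meval (fun i => x 0 i)))).
rewrite -[LHS]/(horner_eval s _) (rmorph_mmap (horner_eval s)).
apply: eq_mmap => [b|i] /=; first by rewrite map_polyC /= mevalC /horner_eval hornerC.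
case: (split_ordP i) => j ->; rewrite ?fcatl ?fcatr /horner_eval.
  by rewrite map_polyC /= mevalXU hornerC.
rewrite map_polyZ map_polyX hornerZ hornerX; congr (_ * _); exact: xi_eval.
Qed.

Let tangent_part_eval P (x : 'rV[R]_n) s :
  (map_poly (meval (fun i => x 0 i)) (tangent_part P)).[s] =
  meval (fcat (fun i => z 0 i) (fun i => peval (proj_xi i) x * s)) P.
Proof.
rewrite (rmorph_mmap (map_poly (meval (fun i => x 0 i)))).
rewrite -[LHS]/(horner_eval s _) (rmorph_mmap (horner_eval s)).
apply: eq_mmap => [b|i] /=; first by rewrite map_polyC /= mevalC /horner_eval hornerC.
case: (split_ordP i) => j ->; rewrite ?fcatl ?fcatr /horner_eval.
  by rewrite map_polyC /= mevalC hornerC.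
by rewrite map_polyZ map_polyX hornerZ hornerX.
Qed.

(** Along a flow line gamma through z, r vanishes, and (gamma t - z) / t tends to
    the value of the field at z, which is an arbitrary tangent vector. *)
Let leading_form_tangent P r k v : vanishing_ideal V r -> rees z P = r%:P * 'X^k ->
  meval (fcat (fun i => z 0 i) (fun i => peval (tangent_field l g v i) z)) P = 0.
Proof.
move=> rV e.
have [gamma [gV0 lim gz _]] := tangent_flow_line irrV dimV Vz gV Jz v Vz.
pose phi t := fcat (fun i => gamma t 0 i) (fun i => (gamma t 0 i - z 0 i) / t).
have xi_lim i : (gamma t 0 i - z 0 i) / t @[t --> 0^'] --> peval (tangent_field l g v i) z.
  have h : peval (xi i) (gamma t) / t ^+ 1 @[t --> 0^'] -->
      peval (iter 1 (vfield (tangent_field l g v)) (xi i)) z / 1`!%:R.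
    by apply: lim => -[|//] _; rewrite /= xi_eval subrr.
  rewrite (_ : peval _ z / _ = peval (tangent_field l g v i) z) in h; last first.
    rewrite /= -[1`!]/1%N divr1 vfieldB vfieldC subr0 /vfield (bigD1 i) //= big1.
      by rewrite addr0 mderiv_var eqxx mulr1.
    by move=> j ne; rewrite mderiv_var (negbTE ne) mulr0.
  apply: (near_eq_limit _ h); apply: filterE => t.
  by rewrite xi_eval expr1.
have coord_lim i : gamma t 0 i @[t --> 0^'] --> z 0 i.
  have h : peval (mpolyX R (mnm1 i)) (gamma t) / t ^+ 0 @[t --> 0^'] -->
      peval (mpolyX R (mnm1 i)) z / 0`!%:R by apply: (lim _ 0%N).
  rewrite fact0 divr1 {2}/peval mevalXU in h.
  apply: (near_eq_limit _ h); apply: filterE => t.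
  by rewrite expr0 divr1 /peval mevalXU.
apply: (@near_cst_limit _ _ 0^' _ (fun t => meval (phi t) P)).
  apply: meval_cvg => i; rewrite /phi; case: (split_ordP i) => j ->.
    by rewrite fcatl; under eq_fun do rewrite fcatl; exact: coord_lim.
  by rewrite fcatr; under eq_fun do rewrite fcatr; exact: xi_lim.
apply: filterS gV0 => t gt; rewrite /phi -rees_eval e rmorphM /= map_polyC /=.
by rewrite -/(peval r (gamma t)) gt // mul0r horner0.
Qed.

Let tangent_part_eq0 P r k : vanishing_ideal V r -> rees z P = r%:P * 'X^k ->
  tangent_part P = 0.
Proof.
move=> rV e.
have proj_tangent (x : 'rV[R]_n) s : exists v, forall i,
    peval (proj_xi i) x * s = peval (tangent_field l g v i) z.
  pose v a := (\sum_j M (lshift c a) j * (x 0 j - z 0 j)) * s / peval (jacobian u) z.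
  exists v => i; pose w := \col_i peval (tangent_field l g v i) z.
  have Mw : M *m w = \col_k (fcat v (fun=> 0) k * peval (jacobian u) z).
    apply/matrixP => k0 j; rewrite !mxE -[in RHS](pevalC (fcat v (fun=> 0) k0) z).
    rewrite -pevalM -adjugate_fieldE peval_vfield.
    by apply: eq_bigr => b _; rewrite !mxE mulrC.
  have -> : peval (tangent_field l g v i) z = w i 0 by rewrite mxE.
  rewrite -(mulKmx M_unit w) Mw mxE big_split_ord /= [X in _ + X]big1 => [|b _]; last first.
    by rewrite mxE fcatr mul0r mulr0.
  rewrite addr0 /proj_xi /peval raddf_sum mulr_suml; apply: eq_bigr => a _ /=.
  rewrite mxE fcatl /v divfK // raddf_sum /= mulr_suml mulr_suml mulr_sumr.
  apply: eq_bigr => b _; rewrite -!/(peval _ x) pevalM pevalC xi_eval; ring.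
have all0 (x : 'rV[R]_n) : map_poly (meval (fun i => x 0 i)) (tangent_part P) = 0.
  apply: poly_fun_eq0 => s; rewrite tangent_part_eval.
  have [v hv] := proj_tangent x s.
  rewrite -[RHS](leading_form_tangent v rV e); apply: eq_mmap => // i.
  by case: (split_ordP i) => j ->; rewrite ?fcatl ?fcatr.
apply/polyP => j; rewrite coef0; apply: mpoly_fun_eq0 => y.
have /(congr1 (fun p : {poly R} => p`_j)) := all0 (\row_i y i).
by rewrite coef_map coef0 /= => h; rewrite -[RHS]h; apply: meval_eq => i; rewrite mxE.
Qed.

(** If h - f lies in m ^ k, its leading form vanishes on the tangent space, hence
    is a combination of the linear parts of the g j: subtracting the corresponding
    combination of the g j raises the order. *)
Lemma vanishing_ideal_approx h k : vanishing_ideal V h ->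
  exists2 f, vanishing_ideal X f & max_pow z k (h - f).
Proof.
move=> hV; elim: k => [|k [f fX [P e]]].
  by exists 0; [move=> x _; exact: peval0|exact: max_pow0].
have rV : vanishing_ideal V (h - f) by apply: vanishing_idealB => //; exact: sub_ideal.
have [f' f'X] := rees_tangent_part P k.
rewrite (tangent_part_eq0 rV e) coef0 subr0 e coefCM coefXn eqxx mulr1.
rewrite -addrA -opprD => hf; exists (f + f') => //.
by move=> x Xx; rewrite pevalD fX // f'X // addr0.
Qed.

(** A nonsingular point lies on a single component: by Krull's theorem every h in
    the ideal of V vanishes on X near z, and as this ideal has finitely many
    generators, one Zariski neighbourhood of z suits all of them. *)
Lemma locally_irreducible : exists2 s, peval s z != 0 &
  forall h, vanishing_ideal V h -> vanishing_ideal X (s * h).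
Proof.
have idX := vanishing_ideal_is_ideal X.
have [L [LV Lgen]] := hilbert_basis (vanishing_ideal_is_ideal V).
have [s sz sL] : exists2 s, peval s z != 0 & forall p, p \in L -> vanishing_ideal X (s * p).
  elim: L LV {Lgen} => [|p L IH] LV; first by exists 1 => //; rewrite peval1 oner_neq0.
  have [|s sz sL] := IH; first by move=> q qL; apply: LV; rewrite inE qL orbT.
  have [|s' s'z s'p] := @krull_intersection _ _ z (vanishing_ideal X) p idX.
    by move=> k; apply: vanishing_ideal_approx; apply: LV; rewrite inE eqxx.
  exists (s * s'); first by rewrite pevalM mulf_neq0.
  move=> q; rewrite inE => /orP[/eqP -> x Xx|/sL qX x Xx].
    by rewrite -mulrA pevalM s'p // mulr0.
  by rewrite mulrAC pevalM qX // mul0r.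
exists s => // h /Lgen [b ->] x Xx; rewrite mulr_sumr /peval raddf_sum big1 // => i _.
rewrite /= -/(peval _ x) mulrCA pevalM sL ?mulr0 //; exact: mem_nth.
Qed.
End Krull.

(** * Regularity of the restriction *)

Section ZariskiOpen.
Variables (R : realType) (n : nat).

Lemma zopen_nonvanishing (p : mpoly n R) : zopen [set x | peval p x != 0].
Proof.
exists [set p]; apply/seteqP; split=> [x /negP/negPn/eqP hx _ ->//|x hx].
by apply/negP/negPn/eqP; exact: hx.
Qed.

Lemma zopen_basis (U : set 'rV[R]_n) x : zopen U -> U x ->
  exists2 p, peval p x != 0 & forall y, peval p y != 0 -> U y.
Proof.
move=> [S SU] Ux; have [p Sp px] : exists2 p, S p & peval p x != 0.
  apply: contrapT => no; have : (~` U) x; last by [].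
  rewrite SU => p Sp; apply/eqP/negPn/negP => px; apply: no; by exists p.
exists p => // y py; apply: contrapT => nU; have : (~` U) y by [].
by rewrite SU => /(_ p Sp)/eqP; rewrite (negbTE py).
Qed.

Lemma zdense_nonvanishing (Z : set 'rV[R]_n) (w : mpoly n R) : irreducible Z ->
  ~ vanishing_ideal Z w -> zdense_in Z (Z `&` [set x | peval w x != 0]).
Proof.
move=> irrZ wZ; split=> [x []//|x Zx p hp].
have [|/wZ //|/(_ x Zx) //] := @irreducible_prime _ _ Z w p irrZ.
move=> y Zy; rewrite pevalM; have [->|wy] := eqVneq (peval w y) 0; first by rewrite mul0r.
by rewrite hp ?mulr0.
Qed.

Lemma regular_on_fraction (A : set 'rV[R]_n) h (p q : mpoly n R) :
  (forall x, A x -> peval q x != 0 /\ h x = peval p x / peval q x) -> regular_on A h.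
Proof.
move=> hA x Ax; exists p, q, [set y | peval q y != 0]; split.
- exact: zopen_nonvanishing.
- by have [] := hA x Ax.
- by have [] := hA x Ax.
- by move=> y Ay _; exact: hA.
Qed.

(** A single fraction represents the function near a point a; multiplying
    numerator and denominator by a polynomial vanishing off that neighbourhood
    turns it into an identity on all of X. *)
Lemma continuous_extension_fraction (X : set 'rV[R]_n) (f : rational_function X)
    (fc : 'rV[R]_n -> R) (s : mpoly n R) :
  continuous_extension f fc -> ~ vanishing_ideal X s ->
  exists p q, [/\ exists a, [/\ X a, peval s a != 0 & peval q a != 0] &
    forall x, X x -> fc x * peval q x = peval p x].
Proof.
move=> [_ [U [[O O_open UO] [UX Udense] Udom fcE]]] sX.
have [a Ua sa] : exists2 a, U a & peval s a != 0.
  by apply: not_vanishing => sU; apply: sX => x /Udense; apply.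
have [p [q [O' [O'_open O'a qa pq]]]] := rat_fun_regular (Udom _ Ua).
have Oa : O a by move: Ua; rewrite UO => -[].
have [r ra rO] := zopen_basis O_open Oa.
have [r' r'a r'O] := zopen_basis O'_open O'a.
exists (p * (r * r')), (q * (r * r')); split.
  by exists a; rewrite !pevalM !mulf_neq0 //; split=> //; exact: UX.
move=> x Xx; rewrite !pevalM.
have [->|rx] := eqVneq (peval r x) 0; first by rewrite !mul0r !mulr0.
have [->|r'x] := eqVneq (peval r' x) 0; first by rewrite !mulr0.
have Ux : U x by rewrite UO; split=> //; exact: rO.
have [qx fx] := pq x (Udom _ Ux) (r'O _ r'x).
by rewrite fcE // fx mulrA divfK.
Qed.
End ZariskiOpen.

(** Dividing fc * q = p by t ^+ j along gamma and letting t tend to 0 compares the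
    coefficients of p with those of q, one degree after the other. *)
Lemma leading_quotient (R : realType) n (X : set 'rV[R]_n) (fc : 'rV[R]_n -> R)
    (p q : mpoly n R) (a : 'I_n -> mpoly n R) (y : 'rV[R]_n) (gamma : R -> 'rV[R]_n) m :
  (forall x, X x -> fc x * peval q x = peval p x) ->
  (\forall t \near 0^', X (gamma t)) -> fc (gamma t) @[t --> 0^'] --> fc y ->
  (forall F j, (forall k, (k < j)%N -> peval (iter k (vfield a) F) y = 0) ->
      peval F (gamma t) / t ^+ j @[t --> 0^'] -->
        peval (iter j (vfield a) F) y / j`!%:R) ->
  (forall k, (k < m)%N -> peval (iter k (vfield a) q) y = 0) ->
  peval (iter m (vfield a) p) y = fc y * peval (iter m (vfield a) q) y.
Proof.
move=> fcpq gX fc_lim lim qm.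
suff h j : (j <= m)%N -> (forall k, (k < j)%N -> peval (iter k (vfield a) p) y = 0) /\
    peval (iter j (vfield a) p) y = fc y * peval (iter j (vfield a) q) y.
  by have [] := h m (leqnn m).
elim/ltn_ind: j => j IH jm.
have pj k : (k < j)%N -> peval (iter k (vfield a) p) y = 0.
  move=> kj; have km : (k < m)%N by exact: leq_trans kj jm.
  by have [_ ->] := IH k kj (ltnW km); rewrite qm // mulr0.
split=> //; have qj k : (k < j)%N -> peval (iter k (vfield a) q) y = 0.
  by move=> kj; apply: qm; exact: leq_trans kj jm.
have h : fc (gamma t) * (peval q (gamma t) / t ^+ j) @[t --> 0^'] -->
    fc y * (peval (iter j (vfield a) q) y / j`!%:R).
  by apply: cvgM => //; exact: lim.
have h' : peval p (gamma t) / t ^+ j @[t --> 0^'] -->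
    fc y * (peval (iter j (vfield a) q) y / j`!%:R).
  apply: (near_eq_limit _ h); apply: filterS gX => t gt.
  by rewrite mulrA fcpq.
have e := cvg_unique (@norm_hausdorff _ R) (lim p j pj) h'.
have j_neq0 : j`!%:R^-1 != 0 :> R by rewrite invr_eq0 pnatr_eq0 -lt0n fact_gt0.
by apply: (mulIf j_neq0); rewrite -mulrA; exact: e.
Qed.

Theorem proposition7 (R : realType) (n : nat) (X Z : set 'rV[R]_n)
    (hX : real_variety X)
    (hZ : real_variety Z) (hZX : Z `<=` X) (hZirr : irreducible Z)
    (hZsing : ~ (Z `<=` singular_locus X))
    (f : rational_function X) (fc : 'rV[R]_n -> R)
    (hfc : continuous_extension f fc) :
  exists Z0 : set 'rV[R]_n,
    [/\ zopen_in Z Z0, zdense_in Z Z0 & regular_on Z0 fc].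
Proof.
have [z Zz [d [[[V [V_closed irrV Vz dimV]] _] tangent]]] :
    exists2 z, Z z & nonsingular_at X z.
  apply: contrapT => no; apply: hZsing => z Zz; split; first exact: hZX.
  by move=> nonsing; apply: no; exists z.
have [F F_closed VF] := V_closed.
have VX : V `<=` X by rewrite VF => x [].
have [c [g [B [n_eq gX Bg_free]]]] := tangent_complement tangent.
subst n.
pose l i : mpoly (d + c) R := \sum_j mpolyC _ (B i j) * mpolyX R (mnm1 j).
have Jz : peval (jacobian (fcat l g)) z != 0.
  apply: jacobian_neq0; suff -> : gradient_mx (fcat l g) z = col_mx B (gradient_mx g z) by [].
  apply/matrixP => i j; rewrite mxE; case: (split_ordP i) => a ->.
    rewrite fcatl col_mxEu /l raddf_sum /= /peval raddf_sum (bigD1 j) //= big1 => [|b ne].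
      by rewrite mul_mpolyC mderivZ mderiv_var eqxx mevalZ meval1 mulr1 addr0.
    by rewrite mul_mpolyC mderivZ mderiv_var eq_sym (negbTE ne) mevalZ meval0 mulr0.
  by rewrite fcatr col_mxEd mxE.
have gV j : vanishing_ideal V (g j) by move=> x /VX; exact: gX.
have [s sz sV] := locally_irreducible irrV dimV Vz VX gX Jz.
(* Near z the variety X, hence also Z, is contained in V. *)
have in_V x : X x -> peval s x != 0 -> V x.
  move=> Xx sx; rewrite VF; split=> //; case: F_closed => S FS; rewrite FS => p Sp.
  have /sV/(_ x Xx) : vanishing_ideal V p by move=> y; rewrite VF FS => -[_]; apply.
  by rewrite pevalM => /eqP; rewrite mulf_eq0 (negbTE sx) => /eqP.
have sX : ~ vanishing_ideal X s by move/(_ z (hZX _ Zz))/eqP; rewrite (negbTE sz).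
have [p [q [[a [Xa sa qa]] fcpq]]] := continuous_extension_fraction hfc sX.
have qV : ~ vanishing_ideal V q.
  by move/(_ a (in_V _ Xa sa))/eqP; rewrite (negbTE qa).
have [v [k qk]] := transversal_field irrV dimV Vz gV Jz qV.
pose D := vfield (tangent_field l g v).
(* m is the order of q along the flow lines that start at general points of Z. *)
have ex_m : exists m, `[< ~ vanishing_ideal Z (iter m D q) >].
  by exists k; apply/asboolP => /(_ z Zz)/eqP; rewrite (negbTE qk).
have [m /asboolP qm m_min] := ex_minnP ex_m.
have q_low j y : Z y -> (j < m)%N -> peval (iter j D q) y = 0.
  move=> Zy jm; have [h|] := pselect (vanishing_ideal Z (iter j D q)); first exact: h.
  by move/asboolP/m_min; rewrite leqNgt jm.
pose w := s * iter m D q.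
have wZ : ~ vanishing_ideal Z w.
  move/(irreducible_prime hZirr) => [|//].
  by move/(_ z Zz)/eqP; rewrite (negbTE sz).
exists (Z `&` [set x | peval w x != 0]); split.
- by exists [set x | peval w x != 0]; [exact: zopen_nonvanishing|].
- exact: zdense_nonvanishing.
apply: (@regular_on_fraction _ _ _ _ (iter m D p) (iter m D q)) => y [Zy].
rewrite /= pevalM mulf_eq0 negb_or => /andP[sy qy]; split=> //.
have Vy : V y by apply: in_V => //; exact: hZX.
have [gamma [gamma_V lim gamma_y _]] := tangent_flow_line irrV dimV Vz gV Jz v Vy.
have gamma_X : \forall t \near 0^', X (gamma t).
  have [F1 [U1 [[S1 F1E] U1_open XE]]] := hX.
  have U1y : U1 y by move: (VX _ Vy); rewrite XE => -[].
  have [r ry rU1] := zopen_basis U1_open U1y.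
  have r_lim : peval r (gamma t) @[t --> 0^'] --> peval r y.
    have h : peval r (gamma t) / t ^+ 0 @[t --> 0^'] --> peval r y / 0`!%:R.
      by apply: (lim r 0%N).
    rewrite fact0 divr1 in h; apply: (near_eq_limit _ h).
    by apply: filterE => t; rewrite expr0 divr1.
  have r_neq0 : \forall t \near 0^', peval r (gamma t) != 0 by apply: cvgr_neq0 r_lim ry.
  apply: filterS2 gamma_V r_neq0 => t gV1 rt; rewrite XE; split; last exact: rU1.
  by rewrite F1E => p1 Sp1; apply: gV1 => x /VX; rewrite XE F1E => -[h _]; exact: h.
have fc_lim : fc (gamma t) @[t --> 0^'] --> fc y.
  have /subspace_continuousP/(_ y (VX _ Vy)) fc_y := hfc.1.
  apply: cvg_trans fc_y => A hA; have := gamma_y _ hA; apply: filterS2 gamma_X.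
  by move=> t Xt /(_ Xt).
rewrite (leading_quotient fcpq gamma_X fc_lim lim (fun j => q_low j y Zy)).
by rewrite mulfK.
Qed.
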